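(* Suppose that $f(z)=h(z)+\overline{g(z)}=\sum_{n=0}^{\infty}a_nz^n+\overline{\sum_{n=1}^{\infty}b_nz^n}$ is a sense-preserving $K$-quasiconformal harmonic mapping in $\mathbb{D}$ and $h\prec\phi$, where $\phi$ is an analytic convex univalent function in $\mathbb{D}$. Then for arbitrary $\lambda>0$ and $m\in\mathbb{N}$, the inequality $$|h(z^m)|+\lambda\sum_{n=1}^{\infty}(|a_n|+|b_n|)r^n\le|\phi(0)|+d(\phi(0),\partial\phi(\mathbb{D}))$$ holds for $|z|=r\le R^*_{K,m,\lambda}$, where $R^*_{K,m,\lambda}$ is the unique root in $(0,1)$ of the equation $$E^{\lambda}_{K,m}(r):=\frac{r^m}{1-r^m}+\frac{2K\lambda r}{(K+1)(1-r)}-\frac12=0 .$$ The radius $R^*_{K,m,\lambda}$ is sharp if $R^*_{K,m,\lambda}\le1/3$.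
   Context: $\mathbb{D}=\{z\in\mathbb{C}:|z|<1\}$. A convex univalent function in $\mathbb{D}$ is an analytic univalent function $\phi$ on $\mathbb{D}$ whose image $\phi(\mathbb{D})$ is a convex set. $d(\phi(0),\partial\phi(\mathbb{D}))$ is the Euclidean distance from $\phi(0)$ to the boundary of $\phi(\mathbb{D})$. For analytic $h,\phi$ in $\mathbb{D}$, $h\prec\phi$ ($h$ is subordinate to $\phi$) means $h=\phi\circ w$ for some analytic $w:\mathbb{D}\to\mathbb{D}$ with $w(0)=0$. A harmonic mapping $f=h+\overline g$ in $\mathbb{D}$ ($h,g$ analytic in $\mathbb{D}$) is sense-preserving $K$-quasiconformal if it is locally univalent and sense-preserving (i.e. $h'\ne0$ and $|\omega|<1$ in $\mathbb{D}$, where $\omega=g'/h'$) and $|\omega(z)|\le k<1$ in $\mathbb{D}$, where $K=(1+k)/(1-k)\ge1$, i.e. $k=(K-1)/(K+1)$. *)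

(* Defs.v *)
From Stdlib Require Import Reals.
From Coquelicot Require Import Coquelicot.

Set Implicit Arguments.

Local Open Scope R_scope.

Definition unit_disk (z : C) : Prop := Cmod z < 1.

Definition analytic_in_disk (f : C -> C) : Prop :=
  forall z : C, unit_disk z -> @ex_derive C_AbsRing C_NormedModule f z.

Definition univalent_in_disk (f : C -> C) : Prop :=
  forall z w : C, unit_disk z -> unit_disk w -> f z = f w -> z = w.

Definition disk_image (f : C -> C) (u : C) : Prop :=
  exists z : C, unit_disk z /\ f z = u.

Definition convex_set (S : C -> Prop) : Prop :=
  forall (u v : C) (t : R), S u -> S v -> 0 <= t <= 1 ->
    S (RtoC (1 - t) * u + RtoC t * v)%C.

Definition convex_univalent (phi : C -> C) : Prop :=
  analytic_in_disk phi /\ univalent_in_disk phi /\ convex_set (disk_image phi).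

(* The closure minus the interior. *)
Definition boundary (S : C -> Prop) (w : C) : Prop :=
  ~ @locally C_UniformSpace w (fun u => ~ S u) /\
  ~ @locally C_UniformSpace w S.

(* An infimum in [Rbar], so that it is [p_infty] for an empty set. *)
Definition dist_to (p : C) (S : C -> Prop) : Rbar :=
  Glb_Rbar (fun d : R => exists w : C, S w /\ d = Cmod (p - w)%C).

Definition subordinate (h phi : C -> C) : Prop :=
  exists w : C -> C,
    analytic_in_disk w /\
    (forall z : C, unit_disk z -> unit_disk (w z)) /\
    w (RtoC 0) = RtoC 0 /\
    (forall z : C, unit_disk z -> h z = phi (w z)).

Definition dilatation (h g : C -> C) (z : C) : C :=
  (C_derive g z / C_derive h z)%C.

(* Local univalence and preservation of orientation are [h' <> 0] and
   [|g' / h'| < 1]; K-quasiconformality is [|g' / h'| <= k] with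
   [K = (1 + k) / (1 - k)]. *)
Definition qc_harmonic (K : R) (f h g : C -> C) : Prop :=
  analytic_in_disk h /\ analytic_in_disk g /\
  (forall z : C, unit_disk z -> f z = (h z + Cconj (g z))%C) /\
  (forall z : C, unit_disk z ->
     C_derive h z <> RtoC 0 /\ Cmod (dilatation h g z) < 1) /\
  (forall z : C, unit_disk z ->
     Cmod (dilatation h g z) <= (K - 1) / (K + 1)).

Definition has_expansion (a : nat -> C) (h : C -> C) : Prop :=
  forall z : C, unit_disk z -> @is_pseries C_AbsRing C_NormedModule a z (h z).

Definition admissible (K : R) (f h g : C -> C) (a b : nat -> C)
    (phi : C -> C) : Prop :=
  qc_harmonic K f h g /\
  has_expansion a h /\ has_expansion b g /\ b 0%nat = RtoC 0 /\
  convex_univalent phi /\ subordinate h phi.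

(* The n-th term is that of index n + 1, as the sum starts at 1. *)
Definition bohr_term (a b : nat -> C) (r : R) (n : nat) : R :=
  (Cmod (a (S n)) + Cmod (b (S n))) * r ^ S n.

Definition bohr_ineq (m : nat) (lambda : R) (h : C -> C) (a b : nat -> C)
    (phi : C -> C) (z : C) : Prop :=
  Rbar_le
    (Finite (Cmod (h (Cpow z m)) + lambda * Series (bohr_term a b (Cmod z))))
    (Rbar_plus (Finite (Cmod (phi (RtoC 0))))
       (dist_to (phi (RtoC 0)) (boundary (disk_image phi)))).

Definition E_fun (K lambda : R) (m : nat) (r : R) : R :=
  r ^ m / (1 - r ^ m) + 2 * K * lambda * r / ((K + 1) * (1 - r)) - 1 / 2.

(* Main.v *)
Require Import Defs.
From Stdlib Require Import Reals Lra Lia Psatz.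
From Coquelicot Require Import Coquelicot.

Local Open Scope R_scope.

(** Write d for the distance from phi(0) to the boundary of the convex set
    T = phi(D), and k = (K - 1) / (K + 1).

    The analytic part satisfies |a_n| <= 2 d for n >= 1. Indeed every point v
    outside T is separated from T by a line, so that for some unit number u the
    function u (h - v) has nonnegative real part on the disk, and Caratheodory's
    inequality |c_n| <= 2 Re c_0 for such functions gives
    |a_n| <= 2 |phi(0) - v| ([coef_le_complement]). Points outside T approach any
    boundary point, whence the bound by 2 d ([subordinate_coef_le]).

    The co-analytic part satisfies
    sum |b_n| r^n <= 2 d k r / (1 - r) for all r < 1 ([coanalytic_sum_le]).
    Since |g'| <= k |h'|, Parseval's identity on circles compares the power
    series with coefficients n^2 |b_n|^2 and n^2 |a_n|^2; dividing by t and
    integrating, twice, removes the weights n^2 and leaves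
    sum |b_n|^2 t^n <= k^2 sum |a_n|^2 t^n ([sum_sq_le_of_derive_le]). The
    estimate of a_n and the inequality of Cauchy and Schwarz then give the claim.

    As 1 + k = 2 K / (K + 1), adding the estimates of h(z^m), of the a_n and of
    the b_n bounds the left-hand side by |phi(0)| + d + 2 d E(r), which is the
    assertion when E(r) <= 0 ([bohr_inequality]). For h = phi = z / (1 - z) and
    g = k h one has d = 1/2, a_n = 1, b_n = k, and at z = r the left-hand side
    equals 1/2 + E(r), so the inequality fails as soon as E(r) > 0
    ([half_plane_bohr_fails]). Monotonicity of E yields its unique root.

    Caratheodory's inequality and Parseval's identity are both obtained from
    means over the roots of unity: for polynomials of degree smaller than the
    number of nodes the orthogonality relations are exact, and power series are
    reached by truncation, the tails being uniformly small on each circle. *)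

(** * Finite complex sums *)

(** The carriers of the hierarchy of algebraic structures hide from [ring] that
    an equation is between reals. *)
Ltac ring_R := match goal with |- @eq _ ?x ?y => change (@eq R x y); ring end.

Definition Csum (u : nat -> C) (N : nat) : C := @sum_n C_AbelianMonoid u N.

Lemma Csum_0 (u : nat -> C) : Csum u 0 = u 0%nat.
Proof. unfold Csum. now rewrite sum_O. Qed.

Lemma Csum_S (u : nat -> C) (N : nat) : Csum u (S N) = (Csum u N + u (S N))%C.
Proof. unfold Csum. now rewrite sum_Sn. Qed.

Lemma Csum_ext (u v : nat -> C) (N : nat) :
  (forall n, (n <= N)%nat -> u n = v n) -> Csum u N = Csum v N.
Proof. intros H. now apply sum_n_ext_loc. Qed.

Lemma Csum_plus (u v : nat -> C) (N : nat) :
  Csum (fun n => u n + v n)%C N = (Csum u N + Csum v N)%C.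
Proof.
  induction N as [|N IH]; [now rewrite !Csum_0|]. rewrite !Csum_S, IH. ring.
Qed.

Lemma Csum_scal (c : C) (u : nat -> C) (N : nat) :
  Csum (fun n => c * u n)%C N = (c * Csum u N)%C.
Proof.
  induction N as [|N IH]; [now rewrite !Csum_0|]. rewrite !Csum_S, IH. ring.
Qed.

Lemma Csum_conj (u : nat -> C) (N : nat) :
  Csum (fun n => Cconj (u n)) N = Cconj (Csum u N).
Proof.
  induction N as [|N IH]; [now rewrite !Csum_0|].
  now rewrite !Csum_S, IH, Cplus_conj.
Qed.

Lemma Csum_Re (u : nat -> C) (N : nat) :
  Re (Csum u N) = sum_n (fun n => Re (u n)) N.
Proof.
  induction N as [|N IH]; [now rewrite Csum_0, sum_O|].
  now rewrite Csum_S, sum_Sn, re_plus, IH.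
Qed.

Lemma Csum_const (c : C) (N : nat) : Csum (fun _ => c) N = (RtoC (INR (S N)) * c)%C.
Proof.
  induction N as [|N IH]; [rewrite Csum_0; simpl; ring|].
  rewrite Csum_S, IH, (S_INR (S N)), RtoC_plus. ring.
Qed.

Lemma sum_n_le_loc (u v : nat -> R) (N : nat) :
  (forall n, (n <= N)%nat -> u n <= v n) -> sum_n u N <= sum_n v N.
Proof.
  intros H. rewrite !sum_n_Reals. now apply sum_Rle.
Qed.

Lemma sum_n_Rplus (u v : nat -> R) (N : nat) :
  sum_n (fun n => u n + v n) N = sum_n u N + sum_n v N.
Proof. exact (sum_n_plus u v N). Qed.

Lemma sum_n_Rscal (c : R) (u : nat -> R) (N : nat) :
  sum_n (fun n => c * u n) N = c * sum_n u N.
Proof. exact (sum_n_mult_l (K := R_Ring) c u N). Qed.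

Lemma Cmod_Csum (u : nat -> C) (N : nat) :
  Cmod (Csum u N) <= sum_n (fun n => Cmod (u n)) N.
Proof.
  induction N as [|N IH]; [rewrite Csum_0, sum_O; lra|].
  rewrite Csum_S, sum_Sn.
  apply Rle_trans with (1 := Cmod_triangle _ _).
  change (plus ?x ?y) with (x + y). lra.
Qed.

(** * Trigonometric sums over the roots of unity *)

(** The order is [S p] so that the exponents 0 to p of a [Csum] up to [p] give each
    root of unity once. *)
Definition primitive_root (p : nat) : C :=
  (cos (2 * PI / INR (S p)), sin (2 * PI / INR (S p))).

Definition node (p j : nat) : C := Cpow (primitive_root p) j.

Lemma cis_pow (t : R) (n : nat) :
  Cpow (cos t, sin t) n = (cos (INR n * t), sin (INR n * t)).
Proof.
  induction n as [|n IH].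
  - simpl. rewrite Rmult_0_l, cos_0, sin_0. reflexivity.
  - rewrite Cpow_S, IH, S_INR.
    replace ((INR n + 1) * t) with (t + INR n * t) by ring.
    rewrite cos_plus, sin_plus. unfold Cmult; simpl. f_equal; ring.
Qed.

Lemma Cmod_primitive_root (p : nat) : Cmod (primitive_root p) = 1.
Proof.
  unfold Cmod, primitive_root. cbn [fst snd].
  pose proof (sin2_cos2 (2 * PI / INR (S p))) as H. unfold Rsqr in H.
  match goal with |- sqrt ?x = 1 => replace x with 1 by (rewrite <- H; ring) end.
  exact sqrt_1.
Qed.

Lemma Cmod_node (p j : nat) : Cmod (node p j) = 1.
Proof.
  unfold node. rewrite Cmod_pow, Cmod_primitive_root. apply pow1.
Qed.

Lemma node_mul_conj (p j : nat) : (node p j * Cconj (node p j))%C = RtoC 1.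
Proof. rewrite <- Cmod2_conj, Cmod_node. f_equal. ring. Qed.

Lemma INR_S_pos (p : nat) : 0 < INR (S p).
Proof. apply lt_0_INR. lia. Qed.

Lemma primitive_root_pow_order (p : nat) : Cpow (primitive_root p) (S p) = RtoC 1.
Proof.
  unfold primitive_root. rewrite cis_pow.
  pose proof (INR_S_pos p) as Hp.
  replace (INR (S p) * (2 * PI / INR (S p))) with (2 * PI) by (field; now apply Rgt_not_eq).
  now rewrite cos_2PI, sin_2PI.
Qed.

Lemma primitive_root_pow_neq_1 (p n : nat) :
  (0 < n < S p)%nat -> Cpow (primitive_root p) n <> RtoC 1.
Proof.
  intros [Hn Hnp] H. unfold primitive_root in H. rewrite cis_pow in H.
  pose proof (INR_S_pos p) as Hp.
  pose proof (lt_0_INR n Hn) as Hn'. pose proof (lt_INR _ _ Hnp) as Hnp'.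
  pose proof PI_RGT_0 as Hpi.
  assert (Hx : 0 < INR n * PI / INR (S p) < PI).
  { split.
    - apply Rdiv_lt_0_compat; [nra|lra].
    - apply Rmult_lt_reg_r with (INR (S p)); [lra|].
      unfold Rdiv. rewrite Rmult_assoc, Rinv_l by lra. nra. }
  pose proof (sin_gt_0 _ (proj1 Hx) (proj2 Hx)) as Hs.
  apply (f_equal fst) in H. cbn [fst RtoC] in H. rename H into Hc.
  replace (INR n * (2 * PI / INR (S p))) with (2 * (INR n * PI / INR (S p))) in Hc
    by (field; now apply Rgt_not_eq).
  rewrite cos_2a_sin in Hc. nra.
Qed.

Lemma geometric_Csum (q : C) (N : nat) :
  ((q - 1) * Csum (fun j => Cpow q j) N)%C = (Cpow q (S N) - 1)%C.
Proof.
  induction N as [|N IH]; [rewrite Csum_0; simpl; ring|].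
  rewrite Csum_S, Cmult_plus_distr_l, IH, (Cpow_S q (S N)). ring.
Qed.

(** A geometric sum of ratio q with q^(p+1) = 1 and q <> 1. *)
Lemma node_pow_sum (p n : nat) :
  (0 < n < S p)%nat -> Csum (fun j => Cpow (node p j) n) p = RtoC 0.
Proof.
  intros Hn.
  set (q := Cpow (primitive_root p) n).
  rewrite (Csum_ext _ (fun j => Cpow q j)).
  2:{ intros j _. unfold node, q. rewrite <- !Cpow_mult_r. f_equal. lia. }
  pose proof (geometric_Csum q p) as H.
  replace (Cpow q (S p)) with (RtoC 1) in H.
  2:{ unfold q. rewrite <- Cpow_mult_r, Nat.mul_comm, Cpow_mult_r,
        primitive_root_pow_order. now rewrite Cpow_1_l. }
  assert (Hq : (q - 1)%C <> RtoC 0).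
  { intros E. apply (primitive_root_pow_neq_1 p n Hn). fold q.
    replace q with ((q - 1) + 1)%C by ring. rewrite E. ring. }
  replace (Csum (fun j => Cpow q j) p)
    with (/ (q - 1) * ((q - 1) * Csum (fun j => Cpow q j) p))%C by (field; exact Hq).
  rewrite H. field. exact Hq.
Qed.

Lemma node_orthogonal_gt (p k n : nat) :
  (n < k)%nat -> (k <= p)%nat ->
  Csum (fun j => Cpow (node p j) k * Cconj (Cpow (node p j) n))%C p = RtoC 0.
Proof.
  intros Hnk Hk.
  rewrite (Csum_ext _ (fun j => Cpow (node p j) (k - n))).
  - apply node_pow_sum. lia.
  - intros j _. replace k with ((k - n) + n)%nat at 1 by lia.
    rewrite Cpow_add_r, Cpow_conj, <- Cmult_assoc, <- Cpow_mult_l, node_mul_conj,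
      Cpow_1_l. ring.
Qed.

Lemma node_orthogonal (p k n : nat) :
  (k <= p)%nat -> (n <= p)%nat -> k <> n ->
  Csum (fun j => Cpow (node p j) k * Cconj (Cpow (node p j) n))%C p = RtoC 0.
Proof.
  intros Hk Hn Hkn. destruct (Nat.lt_ge_cases n k) as [H|H].
  - now apply node_orthogonal_gt.
  - rewrite (Csum_ext _ (fun j =>
      Cconj (Cpow (node p j) n * Cconj (Cpow (node p j) k))%C)).
    + rewrite Csum_conj, node_orthogonal_gt by lia. unfold Cconj; simpl.
      now rewrite Ropp_0.
    + intros j _. rewrite Cmult_conj, Cconj_conj. ring.
Qed.

Definition Cpoly (c : nat -> C) (N : nat) (z : C) : C :=
  Csum (fun n => c n * Cpow z n)%C N.

Lemma Cpoly_S (c : nat -> C) (N : nat) (z : C) :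
  Cpoly c (S N) z = (Cpoly c N z + c (S N) * Cpow z (S N))%C.
Proof. apply Csum_S. Qed.

Lemma Cpoly_0 (c : nat -> C) (z : C) : Cpoly c 0 z = c 0%nat.
Proof. unfold Cpoly. rewrite Csum_0. simpl. ring. Qed.

(** The discrete mean recovers the coefficient without error because all the
    exponents stay below the number [S p] of nodes, hence are pairwise
    incongruent modulo it. *)
Lemma discrete_fourier (c : nat -> C) (p N n : nat) :
  (N <= p)%nat -> (n <= p)%nat ->
  Csum (fun j => Cpoly c N (node p j) * Cconj (Cpow (node p j) n))%C p =
  (if Nat.leb n N then RtoC (INR (S p)) * c n else 0)%C.
Proof.
  intros HN Hn.
  assert (Hterm : forall k, (k <= p)%nat ->
    Csum (fun j => c k * Cpow (node p j) k * Cconj (Cpow (node p j) n))%C p =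
    if Nat.eqb k n then (RtoC (INR (S p)) * c n)%C else RtoC 0).
  { intros k Hk.
    rewrite (Csum_ext _ (fun j =>
      c k * (Cpow (node p j) k * Cconj (Cpow (node p j) n)))%C)
      by (intros; ring).
    rewrite Csum_scal. destruct (Nat.eqb_spec k n) as [->|Hkn].
    - rewrite (Csum_ext _ (fun _ => RtoC 1)).
      + rewrite Csum_const. ring.
      + intros j _. now rewrite Cpow_conj, <- Cpow_mult_l, node_mul_conj, Cpow_1_l.
    - rewrite node_orthogonal by assumption. ring. }
  induction N as [|N IH].
  - rewrite (Csum_ext _ (fun j =>
      c 0%nat * Cpow (node p j) 0 * Cconj (Cpow (node p j) n))%C).
    + rewrite Hterm by lia. now destruct n.
    + intros j _. rewrite Cpoly_0. simpl. ring.
  - rewrite (Csum_ext _ (fun j =>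
      Cpoly c N (node p j) * Cconj (Cpow (node p j) n) +
      c (S N) * Cpow (node p j) (S N) * Cconj (Cpow (node p j) n))%C).
    + rewrite Csum_plus, IH, Hterm by lia.
      destruct (Nat.leb_spec n N); destruct (Nat.leb_spec n (S N));
        destruct (Nat.eqb_spec (S N) n); try lia; ring.
    + intros j _. rewrite Cpoly_S. ring.
Qed.

(** All exponents that occur lie strictly between 0 and the number of nodes. For a
    sum over the whole circle the degree would be unrestricted; this is why
    [caratheodory_circle] takes more nodes than the degree of its polynomial. *)
Lemma node_poly_mul_pow (c : nat -> C) (p N n : nat) :
  (0 < n)%nat -> (N + n <= p)%nat ->
  Csum (fun j => Cpoly c N (node p j) * Cpow (node p j) n)%C p = RtoC 0.
Proof.
  intros Hn. induction N as [|N IH]; intros HN.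
  - rewrite (Csum_ext _ (fun j => c 0%nat * Cpow (node p j) n)%C)
      by (intros; now rewrite Cpoly_0).
    rewrite Csum_scal, node_pow_sum by lia. ring.
  - rewrite (Csum_ext _ (fun j => Cpoly c N (node p j) * Cpow (node p j) n +
      c (S N) * Cpow (node p j) (S N + n))%C).
    + rewrite Csum_plus, Csum_scal, IH, node_pow_sum by lia. ring.
    + intros j _. rewrite Cpoly_S, Cpow_add_r. ring.
Qed.

Lemma Cmod2_plus (x y : C) :
  Cmod (x + y) ^ 2 = Cmod x ^ 2 + Cmod y ^ 2 + 2 * Re (x * Cconj y).
Proof.
  rewrite !Cmod2_alt. destruct x as [a b], y as [c d]. simpl. ring.
Qed.

(** By induction on the degree: the cross term between the new monomial and the
    polynomial of smaller degree is a Fourier coefficient that vanishes. *)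
Lemma discrete_parseval (c : nat -> C) (p N : nat) :
  (N <= p)%nat ->
  sum_n (fun j => Cmod (Cpoly c N (node p j)) ^ 2) p =
  INR (S p) * sum_n (fun n => Cmod (c n) ^ 2) N.
Proof.
  induction N as [|N IH]; intros HN.
  - rewrite sum_O, (sum_n_ext _ (fun _ => Cmod (c 0%nat) ^ 2))
      by (intros; now rewrite Cpoly_0).
    apply sum_n_const.
  - rewrite (sum_n_ext _ (fun j => Cmod (Cpoly c N (node p j)) ^ 2 +
      (Cmod (c (S N)) ^ 2 + 2 * Re (Cconj (c (S N)) *
        (Cpoly c N (node p j) * Cconj (Cpow (node p j) (S N))))%C))).
    + rewrite sum_n_Rplus, IH, sum_n_Rplus, sum_n_const, sum_n_Rscal, <- Csum_Re by lia.
      rewrite Csum_scal, discrete_fourier by lia.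
      replace (Nat.leb (S N) N) with false by (symmetry; apply Nat.leb_gt; lia).
      rewrite Cmult_0_r, re_RtoC, sum_Sn. change (plus ?x ?y) with (x + y). ring_R.
    + intros j. rewrite Cpoly_S, Cmod2_plus, Cmod_mult, Cmod_pow, Cmod_node, pow1, Rmult_1_r.
      rewrite Cmult_conj.
      replace (Cpoly c N (node p j) * (Cconj (c (S N)) * Cconj (Cpow (node p j) (S N))))%C
        with (Cconj (c (S N)) * (Cpoly c N (node p j) * Cconj (Cpow (node p j) (S N))))%C
        by ring.
      ring_R.
Qed.

(** * Absolutely convergent series on the unit circle *)

Lemma sum_n_le_Series (u : nat -> R) (N : nat) :
  (forall n, 0 <= u n) -> ex_series u -> sum_n u N <= Series u.
Proof.
  intros Hu Hex.
  apply (is_lim_seq_incr_compare (sum_n u) (Series u)).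
  - exact (Series_correct u Hex).
  - intros n. rewrite sum_Sn. change (plus ?x ?y) with (x + y).
    specialize (Hu (S n)). lra.
Qed.

Lemma is_series_C (u : nat -> C) (l : C) :
  @is_series C_AbsRing C_NormedModule u l <->
  (forall eps, 0 < eps ->
     exists N, forall n, (N <= n)%nat -> Cmod (Csum u n - l) < eps).
Proof.
  unfold is_series. split.
  - intros H eps Heps.
    exact (proj1 (filterlim_locally_ball_norm (K := C_AbsRing) (U := C_NormedModule)
      (F := eventually) (sum_n u) l) H (mkposreal eps Heps)).
  - intros H. apply (filterlim_locally_ball_norm (K := C_AbsRing) (U := C_NormedModule)).
    intros eps. exact (H eps (cond_pos eps)).
Qed.

Lemma Cmod_Csum_tail (u : nat -> C) (l : C) (N : nat) :
  @is_series C_AbsRing C_NormedModule u l -> ex_series (fun n => Cmod (u n)) ->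
  Cmod (l - Csum u N) <=
  Series (fun n => Cmod (u n)) - sum_n (fun n => Cmod (u n)) N.
Proof.
  intros Hl Hex. apply le_epsilon. intros eps Heps.
  destruct (proj1 (is_series_C u l) Hl eps Heps) as [M HM].
  set (n := (N + M)%nat).
  assert (Hd : forall k, Cmod (Csum u (N + k) - Csum u N) <=
    sum_n (fun n => Cmod (u n)) (N + k) - sum_n (fun n => Cmod (u n)) N).
  { induction k as [|k IH].
    - rewrite Nat.add_0_r.
      replace (Csum u N - Csum u N)%C with (RtoC 0) by ring. rewrite Cmod_0. lra.
    - rewrite Nat.add_succ_r, Csum_S, sum_Sn. change (plus ?x ?y) with (x + y).
      replace (Csum u (N + k) + u (S (N + k)) - Csum u N)%C
        with ((Csum u (N + k) - Csum u N) + u (S (N + k)))%C by ring.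
      eapply Rle_trans; [apply Cmod_triangle|]. lra. }
  specialize (HM n ltac:(unfold n; lia)). specialize (Hd M). fold n in Hd.
  pose proof (sum_n_le_Series (fun n => Cmod (u n)) n (fun n => Cmod_ge_0 _) Hex) as HS.
  replace (l - Csum u N)%C with (- (Csum u n - l) + (Csum u n - Csum u N))%C by ring.
  eapply Rle_trans; [apply Cmod_triangle|]. rewrite Cmod_opp. lra.
Qed.

Lemma is_lim_seq_tail (u : nat -> R) :
  ex_series u -> is_lim_seq (fun N => Series u - sum_n u N) 0.
Proof.
  intros Hex. replace (Finite 0) with (Finite (Series u - Series u)) by (f_equal; ring).
  apply is_lim_seq_minus'; [apply is_lim_seq_const|]. exact (Series_correct u Hex).
Qed.

(** Absolute convergence is required on the circle itself, as this makes the
    truncation errors uniform there. A power series in the open disk gives such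
    sums by dilation, see [circle_sum_dilate]. *)
Definition circle_sum (c : nat -> C) (F : C -> C) : Prop :=
  ex_series (fun n => Cmod (c n)) /\
  forall z, Cmod z = 1 ->
    @is_series C_AbsRing C_NormedModule (fun n => c n * Cpow z n)%C (F z).

Definition tail (c : nat -> C) (N : nat) : R :=
  Series (fun n => Cmod (c n)) - sum_n (fun n => Cmod (c n)) N.

Lemma circle_sum_tail (c : nat -> C) (F : C -> C) (N : nat) (z : C) :
  circle_sum c F -> Cmod z = 1 -> Cmod (F z - Cpoly c N z) <= tail c N.
Proof.
  intros [Hex Hs] Hz.
  assert (Hm : forall n, Cmod (c n * Cpow z n) = Cmod (c n)).
  { intros n. now rewrite Cmod_mult, Cmod_pow, Hz, pow1, Rmult_1_r. }
  unfold tail. rewrite <- (Series_ext _ _ Hm), <- (sum_n_ext _ _ N Hm).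
  apply Cmod_Csum_tail; [now apply Hs|].
  exact (ex_series_ext _ _ (fun n => eq_sym (Hm n)) Hex).
Qed.

(** If P is a polynomial, the mean of P(z) conj(z)^n is c_n and that of
    conj(P(z)) conj(z)^n is 0, so c_n is the mean of 2 Re P(z) conj(z)^n. Its
    modulus is at most twice the mean of |Re P|, which is that of Re P, that is
    Re c_0, when the real part is nonnegative. Truncation makes the real part
    nonnegative up to the tail only. *)
Lemma caratheodory_circle (c : nat -> C) (F : C -> C) (n : nat) :
  circle_sum c F -> (forall z, Cmod z = 1 -> 0 <= Re (F z)) ->
  (1 <= n)%nat -> Cmod (c n) <= 2 * Re (c 0%nat).
Proof.
  intros HF Hpos Hn.
  assert (HN : forall N, (n <= N)%nat ->
    Cmod (c n) <= 2 * (Re (c 0%nat) + 2 * tail c N)).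
  { intros N HnN. set (p := (N + n)%nat). set (P := fun j => Cpoly c N (node p j)).
    (* [S p] nodes, one more than the largest exponent that occurs *)
    assert (Hc : Csum (fun j => RtoC (2 * Re (P j)) * Cconj (Cpow (node p j) n))%C p
                 = (RtoC (INR (S p)) * c n)%C).
    { pose proof (discrete_fourier c p N n ltac:(unfold p; lia) ltac:(unfold p; lia)) as H1.
      replace (Nat.leb n N) with true in H1 by (symmetry; apply Nat.leb_le; lia).
      pose proof (node_poly_mul_pow c p N n ltac:(lia) ltac:(unfold p; lia)) as H2.
      apply (f_equal Cconj) in H2. rewrite <- Csum_conj in H2.
      replace (Cconj (RtoC 0)) with (RtoC 0) in H2
        by (unfold Cconj, RtoC; simpl; now rewrite Ropp_0).
      rewrite <- H1, <- Cplus_0_r, <- H2, <- Csum_plus.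
      apply Csum_ext. intros j _. fold (P j).
      rewrite Cmult_conj, RtoC_mult, re_alt. field. }
    assert (H0 : sum_n (fun j => Re (P j)) p = INR (S p) * Re (c 0%nat)).
    { rewrite <- Csum_Re, <- re_scal_l. f_equal.
      pose proof (discrete_fourier c p N 0 ltac:(unfold p; lia) ltac:(lia)) as H1.
      simpl Nat.leb in H1. rewrite <- H1. apply Csum_ext. intros j _. fold (P j).
      simpl. unfold Cconj, RtoC; simpl. rewrite Ropp_0. fold (RtoC 1).
      symmetry. apply Cmult_1_r. }
    pose proof (INR_S_pos p) as Hp.
    apply Rmult_le_reg_l with (INR (S p)); [exact Hp|].
    replace (INR (S p) * Cmod (c n)) with (Cmod (RtoC (INR (S p)) * c n))
      by (rewrite Cmod_mult, Cmod_R, Rabs_right by lra; reflexivity).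
    rewrite <- Hc.
    apply Rle_trans with (1 := Cmod_Csum _ _).
    apply Rle_trans with (sum_n (fun j => 2 * Re (P j) + 4 * tail c N) p).
    - apply sum_n_le_loc. intros j _.
      rewrite Cmod_mult, Cmod_conj, Cmod_pow, Cmod_node, pow1, Cmod_R, Rmult_1_r.
      pose proof (circle_sum_tail c F N (node p j) HF (Cmod_node p j)) as Ht.
      fold (P j) in Ht.
      pose proof (Hpos (node p j) (Cmod_node p j)) as Hr.
      pose proof (re_le_Cmod (F (node p j) - P j)) as Hre.
      unfold Cminus in Hre. rewrite re_plus, re_opp in Hre. fold (F (node p j) - P j)%C in Hre.
      apply Rabs_le_between in Hre.
      apply Rabs_le. lra.
    - rewrite sum_n_Rplus, sum_n_Rscal, H0, sum_n_const. lra. }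
  replace (2 * Re (c 0%nat)) with (2 * (Re (c 0%nat) + 2 * 0)) by ring.
  apply (is_lim_seq_le_loc (fun _ => Cmod (c n))
    (fun N => 2 * (Re (c 0%nat) + 2 * tail c N)) (Cmod (c n)) (2 * (Re (c 0%nat) + 2 * 0))
    (ex_intro _ n HN)) .
  - apply is_lim_seq_const.
  - apply is_lim_seq_mult'; [apply is_lim_seq_const|].
    apply is_lim_seq_plus'; [apply is_lim_seq_const|].
    apply is_lim_seq_mult'; [apply is_lim_seq_const|].
    apply is_lim_seq_tail, HF.
Qed.

Lemma term_le_Series (u : nat -> R) (n : nat) :
  (forall n, 0 <= u n) -> ex_series u -> u n <= Series u.
Proof.
  intros Hu Hex. apply Rle_trans with (sum_n u n); [|now apply sum_n_le_Series].
  destruct n as [|n]; [rewrite sum_O; lra|]. rewrite sum_Sn.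
  change (plus ?x ?y) with (x + y).
  enough (0 <= sum_n u n) by lra.
  rewrite sum_n_Reals. now apply cond_pos_sum.
Qed.

Lemma ex_series_square (u : nat -> R) :
  (forall n, 0 <= u n) -> ex_series u -> ex_series (fun n => u n ^ 2).
Proof.
  intros Hu Hex.
  apply (ex_series_le (K := R_AbsRing) (V := R_CompleteNormedModule)
    (fun n => u n ^ 2) (fun n => Series u * u n)).
  - intros n. change (norm (u n ^ 2)) with (Rabs (u n ^ 2)).
    pose proof (Hu n). pose proof (term_le_Series u n Hu Hex).
    rewrite Rabs_right by nra. nra.
  - exact (ex_series_scal_l (K := R_AbsRing) (V := R_NormedModule) (Series u) u Hex).
Qed.

(** Parseval's identity is exact for the truncations, and the pointwise bound
    passes to them up to the tails; [e N] gathers these errors. *)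
Lemma parseval_le_circle (c d : nat -> C) (F G : C -> C) (k : R) :
  circle_sum c F -> circle_sum d G -> 0 <= k ->
  (forall z, Cmod z = 1 -> Cmod (G z) <= k * Cmod (F z)) ->
  Series (fun n => Cmod (d n) ^ 2) <= k ^ 2 * Series (fun n => Cmod (c n) ^ 2).
Proof.
  intros HF HG Hk HFG.
  pose proof (ex_series_square _ (fun n => Cmod_ge_0 (c n)) (proj1 HF)) as Hc2.
  pose proof (ex_series_square _ (fun n => Cmod_ge_0 (d n)) (proj1 HG)) as Hd2.
  set (B := Series (fun n => Cmod (c n))).
  set (e := fun N => tail d N + k * tail c N).
  assert (HN : forall N, sum_n (fun n => Cmod (d n) ^ 2) N <=
    k ^ 2 * sum_n (fun n => Cmod (c n) ^ 2) N + e N * (2 * k * B + e N)).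
  { intros N. pose proof (INR_S_pos N) as HM.
    apply Rmult_le_reg_l with (INR (S N)); [exact HM|].
    rewrite Rmult_plus_distr_l, <- Rmult_assoc, (Rmult_comm _ (k ^ 2)), Rmult_assoc.
    rewrite <- !(discrete_parseval _ N N) by lia.
    rewrite <- sum_n_const, <- sum_n_Rscal, <- sum_n_Rplus.
    apply sum_n_le_loc. intros j _.
    set (w := node N j). assert (Hw : Cmod w = 1) by apply Cmod_node.
    pose proof (circle_sum_tail c F N w HF Hw) as Hct.
    pose proof (circle_sum_tail d G N w HG Hw) as Hdt.
    specialize (HFG w Hw).
    assert (HP : Cmod (Cpoly c N w) <= B).
    { eapply Rle_trans; [apply Cmod_Csum|].
      rewrite (sum_n_ext _ (fun n => Cmod (c n))).
      - apply sum_n_le_Series; [intros; apply Cmod_ge_0|apply HF].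
      - intros n. now rewrite Cmod_mult, Cmod_pow, Hw, pow1, Rmult_1_r. }
    assert (HQ : Cmod (Cpoly d N w) <= Cmod (G w) + tail d N).
    { replace (Cpoly d N w) with (G w + - (G w - Cpoly d N w))%C by ring.
      eapply Rle_trans; [apply Cmod_triangle|]. rewrite Cmod_opp. lra. }
    assert (HP' : Cmod (F w) <= Cmod (Cpoly c N w) + tail c N).
    { replace (F w) with (Cpoly c N w + (F w - Cpoly c N w))%C by ring.
      eapply Rle_trans; [apply Cmod_triangle|]. lra. }
    pose proof (Cmod_ge_0 (Cpoly c N w)) as H1.
    pose proof (Cmod_ge_0 (Cpoly d N w)) as H2.
    pose proof (Cmod_ge_0 (F w - Cpoly c N w)) as H3.
    pose proof (Cmod_ge_0 (G w - Cpoly d N w)) as H4.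
    assert (He : 0 <= e N) by (unfold e; nra).
    assert (HQ' : Cmod (Cpoly d N w) <= k * Cmod (Cpoly c N w) + e N)
      by (unfold e; nra).
    assert (HkP : 0 <= k * Cmod (Cpoly c N w) <= k * B) by nra.
    apply Rle_trans with ((k * Cmod (Cpoly c N w) + e N) ^ 2); [|nra].
    apply pow_incr. lra. }
  assert (He : is_lim_seq e 0).
  { replace (Finite 0) with (Finite (0 + k * 0)) by (f_equal; ring).
    apply is_lim_seq_plus'; [apply is_lim_seq_tail, HG|].
    apply is_lim_seq_mult'; [apply is_lim_seq_const|apply is_lim_seq_tail, HF]. }
  replace (k ^ 2 * Series (fun n => Cmod (c n) ^ 2)) with
    (k ^ 2 * Series (fun n => Cmod (c n) ^ 2) + 0 * (2 * k * B + 0)) by ring.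
  refine (is_lim_seq_le _ _ (Finite _) (Finite _) HN _ _).
  - exact (Series_correct _ Hd2).
  - apply is_lim_seq_plus'.
    + apply is_lim_seq_mult'; [apply is_lim_seq_const|exact (Series_correct _ Hc2)].
    + apply is_lim_seq_mult'; [exact He|].
      apply is_lim_seq_plus'; [apply is_lim_seq_const|exact He].
Qed.

(** * Power series in the unit disk *)

Lemma pow_n_Cpow (z : C) (n : nat) : @pow_n C_Ring z n = Cpow z n.
Proof. induction n as [|n IH]; [reflexivity|]. simpl. now rewrite IH. Qed.

Lemma has_expansion_series (a : nat -> C) (h : C -> C) (z : C) :
  has_expansion a h -> Cmod z < 1 ->
  @is_series C_AbsRing C_NormedModule (fun n => a n * Cpow z n)%C (h z).
Proof.
  intros Hh Hz. eapply is_series_ext; [|exact (Hh z Hz)].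
  intros n. change (Cmult (@pow_n C_Ring z n) (a n) = (a n * Cpow z n)%C).
  rewrite pow_n_Cpow. ring.
Qed.

Lemma is_series_C_term (u : nat -> C) (l : C) :
  @is_series C_AbsRing C_NormedModule u l -> is_lim_seq (fun n => Cmod (u n)) 0.
Proof.
  intros H. apply is_lim_seq_spec. intros eps.
  pose proof (cond_pos eps) as Heps.
  destruct (proj1 (is_series_C u l) H (eps / 2) ltac:(lra)) as [N HN].
  exists (S N). intros [|n] Hn; [lia|].
  pose proof (HN (S n) ltac:(lia)) as H1. pose proof (HN n ltac:(lia)) as H2.
  rewrite Rminus_0_r, Rabs_right by (apply Rle_ge, Cmod_ge_0).
  replace (u (S n)) with ((Csum u (S n) - l) + - (Csum u n - l))%C
    by (rewrite Csum_S; ring).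
  eapply Rle_lt_trans; [apply Cmod_triangle|]. rewrite Cmod_opp. lra.
Qed.

(** Beyond the radius of convergence the terms of a power series do not tend to
    zero. *)
Lemma CV_radius_ge_1 (u : nat -> R) :
  (forall r, 0 < r < 1 -> is_lim_seq (fun n => u n * r ^ n) 0) ->
  Rbar_le 1 (CV_radius u).
Proof.
  intros H. destruct (Rbar_le_lt_dec 1 (CV_radius u)) as [Hle|Hlt]; [exact Hle|].
  exfalso. pose proof (CV_radius_ge_0 u) as H0.
  destruct (CV_radius u) as [R0| |] eqn:E; simpl in Hlt, H0; try easy.
  apply (CV_disk_outside u ((R0 + 1) / 2)).
  - rewrite E. simpl. rewrite Rabs_right; lra.
  - apply H. lra.
Qed.

Lemma ex_series_in_disk (u : nat -> R) (r : R) :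
  Rbar_le 1 (CV_radius u) -> 0 <= r < 1 -> ex_series (fun n => Rabs (u n) * r ^ n).
Proof.
  intros Hu Hr.
  eapply ex_series_ext; [|apply (CV_disk_inside u r)].
  - intros n. cbv beta. rewrite Rabs_mult. f_equal. apply Rabs_right, Rle_ge, pow_le. lra.
  - apply Rbar_lt_le_trans with (2 := Hu). simpl. rewrite Rabs_right; lra.
Qed.

Lemma has_expansion_radius (a : nat -> C) (h : C -> C) :
  has_expansion a h -> Rbar_le 1 (CV_radius (fun n => Cmod (a n))).
Proof.
  intros Hh. apply CV_radius_ge_1. intros r Hr.
  assert (Hm : Cmod (RtoC r) = r) by (rewrite Cmod_R; apply Rabs_right; lra).
  eapply is_lim_seq_ext.
  2:{ apply (is_series_C_term (fun n => a n * Cpow (RtoC r) n)%C (h (RtoC r))).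
      apply has_expansion_series; [exact Hh|]. rewrite Hm. lra. }
  intros n. simpl. now rewrite Cmod_mult, Cmod_pow, Hm.
Qed.

Lemma ex_series_Cmod (a : nat -> C) (h : C -> C) (r : R) :
  has_expansion a h -> 0 <= r < 1 -> ex_series (fun n => Cmod (a n) * r ^ n).
Proof.
  intros Hh Hr.
  eapply ex_series_ext; [|apply (ex_series_in_disk _ r (has_expansion_radius a h Hh) Hr)].
  intros n. simpl. rewrite Rabs_right; [reflexivity|apply Rle_ge, Cmod_ge_0].
Qed.

Lemma circle_sum_dilate (a : nat -> C) (h : C -> C) (r : R) :
  has_expansion a h -> 0 <= r < 1 ->
  circle_sum (fun n => a n * RtoC (r ^ n))%C (fun z => h (RtoC r * z)%C).
Proof.
  intros Hh Hr. split.
  - eapply ex_series_ext; [|apply (ex_series_Cmod a h r Hh Hr)].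
    intros n. simpl. rewrite Cmod_mult, Cmod_R. f_equal.
    symmetry. apply Rabs_right, Rle_ge, pow_le. lra.
  - intros z Hz.
    eapply is_series_ext; [|apply (has_expansion_series a h (RtoC r * z)%C Hh)].
    + intros n. simpl. rewrite Cpow_mult_l, RtoC_pow. ring.
    + rewrite Cmod_mult, Cmod_R, Hz, Rabs_right; lra.
Qed.

Lemma le_of_le_mul_pow (A B : R) (n : nat) :
  (forall r, 0 <= r < 1 -> A * r ^ n <= B) -> A <= B.
Proof.
  intros H.
  assert (Hu : is_lim_seq (fun j => 1 - / (INR j + 1)) 1).
  { replace (Finite 1) with (Finite (1 - 0)) by (f_equal; ring).
    apply is_lim_seq_minus'; [apply is_lim_seq_const|].
    apply is_lim_seq_ext with (fun j => / INR (S j)).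
    { intros j. now rewrite S_INR. }
    apply (is_lim_seq_incr_1 (fun j => / INR j)).
    replace (Finite 0) with (Rbar_inv p_infty) by reflexivity.
    apply is_lim_seq_inv; [apply is_lim_seq_INR|easy]. }
  replace A with (A * 1 ^ n) by (rewrite pow1; ring).
  refine (is_lim_seq_le (fun j => A * (1 - / (INR j + 1)) ^ n) (fun _ => B)
    (Finite _) (Finite _) _ _ (is_lim_seq_const B)).
  - intros j. apply H. pose proof (pos_INR j).
    assert (0 < / (INR j + 1)) by (apply Rinv_0_lt_compat; lra).
    assert (/ (INR j + 1) <= 1) by (rewrite <- Rinv_1; apply Rinv_le_contravar; lra).
    lra.
  - apply (is_lim_seq_continuous (fun r => A * r ^ n) _ 1); [|exact Hu].
    apply derivable_continuous_pt. reg.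
Qed.

Lemma caratheodory_disk (c : nat -> C) (F : C -> C) (n : nat) :
  has_expansion c F -> (forall z, Cmod z < 1 -> 0 <= Re (F z)) ->
  (1 <= n)%nat -> Cmod (c n) <= 2 * Re (c 0%nat).
Proof.
  intros HF Hpos Hn. apply le_of_le_mul_pow with n. intros r Hr.
  pose proof (caratheodory_circle _ _ n (circle_sum_dilate c F r HF Hr)) as H.
  cbv beta in H.
  rewrite Cmod_mult, Cmod_R, Rabs_right in H by (apply Rle_ge, pow_le; lra).
  replace (c 0%nat * RtoC (r ^ 0))%C with (c 0%nat) in H by (simpl; ring).
  apply H; [|exact Hn].
  intros z Hz. apply Hpos. rewrite Cmod_mult, Cmod_R, Hz, Rabs_right; lra.
Qed.

Lemma Cmod_dilated_sq (c : nat -> C) (r : R) (t : R) :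
  t = r ^ 2 -> 0 <= r ->
  forall n, Cmod (c n * RtoC (r ^ n)) ^ 2 = Cmod (c n) ^ 2 * t ^ n.
Proof.
  intros -> Hr n.
  rewrite Cmod_mult, Cmod_R, Rabs_right by (apply Rle_ge, pow_le; lra).
  rewrite <- pow_mult, Nat.mul_comm, pow_mult. ring.
Qed.

Lemma ex_series_sq_disk (c : nat -> C) (F : C -> C) (t : R) :
  has_expansion c F -> 0 <= t < 1 -> ex_series (fun n => Cmod (c n) ^ 2 * t ^ n).
Proof.
  intros HF Ht.
  assert (Hr : 0 <= sqrt t < 1).
  { split; [apply sqrt_pos|]. rewrite <- sqrt_1. apply sqrt_lt_1; lra. }
  eapply ex_series_ext.
  { apply (Cmod_dilated_sq c (sqrt t)); [now rewrite pow2_sqrt|lra]. }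
  apply (ex_series_square (fun n => Cmod (c n * RtoC (sqrt t ^ n)))).
  - intros; apply Cmod_ge_0.
  - apply (circle_sum_dilate c F (sqrt t) HF Hr).
Qed.

Lemma parseval_le_disk (c d : nat -> C) (F G : C -> C) (k t : R) :
  has_expansion c F -> has_expansion d G -> 0 <= k ->
  (forall z, Cmod z < 1 -> Cmod (G z) <= k * Cmod (F z)) -> 0 <= t < 1 ->
  Series (fun n => Cmod (d n) ^ 2 * t ^ n) <=
  k ^ 2 * Series (fun n => Cmod (c n) ^ 2 * t ^ n).
Proof.
  intros HF HG Hk H Ht.
  assert (Hr : 0 <= sqrt t < 1).
  { split; [apply sqrt_pos|]. rewrite <- sqrt_1. apply sqrt_lt_1; lra. }
  assert (Hsq : t = sqrt t ^ 2) by now rewrite pow2_sqrt.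
  pose proof (parseval_le_circle _ _ _ _ k (circle_sum_dilate c F (sqrt t) HF Hr)
    (circle_sum_dilate d G (sqrt t) HG Hr) Hk) as HP.
  cbv beta in HP.
  rewrite (Series_ext _ _ (Cmod_dilated_sq c (sqrt t) t Hsq (proj1 Hr))) in HP.
  rewrite (Series_ext _ _ (Cmod_dilated_sq d (sqrt t) t Hsq (proj1 Hr))) in HP.
  apply HP. intros z Hz. apply H. rewrite Cmod_mult, Cmod_R, Hz, Rabs_right; lra.
Qed.

(** * Termwise differentiation *)

Lemma is_derive_C (f : C -> C) (z l : C) :
  (forall eps, 0 < eps -> exists delta, 0 < delta /\
     forall y, Cmod (y - z) < delta ->
       Cmod (f y - f z - (y - z) * l) <= eps * Cmod (y - z)) ->
  @is_derive C_AbsRing C_NormedModule f z l.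
Proof.
  intros H. split; [apply is_linear_scal_l|].
  intros x Hx.
  apply (is_filter_lim_locally_unique (K := C_AbsRing)
    (V := AbsRing_NormedModule C_AbsRing)) in Hx.
  subst x.
  intros eps. destruct (H eps (cond_pos eps)) as [delta [Hd Hy]].
  exists (mkposreal delta Hd). exact Hy.
Qed.

Lemma Cmod_is_series_le (u : nat -> C) (v : nat -> R) (l : C) (L : R) :
  @is_series C_AbsRing C_NormedModule u l -> is_series v L ->
  (forall n, Cmod (u n) <= v n) -> Cmod l <= L.
Proof.
  intros Hu Hv Huv. apply le_epsilon. intros eps Heps.
  destruct (proj1 (is_series_C u l) Hu eps Heps) as [N HN].
  specialize (HN N (le_n N)).
  pose proof (sum_n_le_Series v N
    (fun n => Rle_trans _ _ _ (Cmod_ge_0 _) (Huv n)) (ex_intro _ L Hv)) as HS.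
  rewrite (is_series_unique _ _ Hv) in HS.
  pose proof (Cmod_Csum u N) as HC.
  pose proof (sum_n_le_loc _ _ N (fun n _ => Huv n)) as Hle. cbv beta in Hle.
  replace l with (- (Csum u N - l) + Csum u N)%C by ring.
  eapply Rle_trans; [apply Cmod_triangle|]. rewrite Cmod_opp. lra.
Qed.

(** The remainder of the first-order expansion of a monomial expands with
    nonnegative coefficients, so moduli may be taken inside. *)
Lemma Cmod_taylor_monomial (z w : C) (n : nat) :
  Cmod (Cpow (z + w) (S n) - Cpow z (S n) - RtoC (INR (S n)) * w * Cpow z n) <=
  (Cmod z + Cmod w) ^ S n - Cmod z ^ S n - INR (S n) * Cmod w * Cmod z ^ n.
Proof.
  pose proof (Cmod_ge_0 z) as Hz. pose proof (Cmod_ge_0 w) as Hw.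
  induction n as [|n IH].
  - replace (Cpow (z + w) 1 - Cpow z 1 - RtoC (INR 1) * w * Cpow z 0)%C with (RtoC 0)
      by (simpl; ring).
    rewrite Cmod_0. simpl. lra.
  - set (E := (Cpow (z + w) (S n) - Cpow z (S n) - RtoC (INR (S n)) * w * Cpow z n)%C) in *.
    replace (Cpow (z + w) (S (S n)) - Cpow z (S (S n)) -
        RtoC (INR (S (S n))) * w * Cpow z (S n))%C
      with ((z + w) * E + RtoC (INR (S n)) * (w * w) * Cpow z n)%C.
    2:{ unfold E. rewrite (S_INR (S n)), RtoC_plus, !(Cpow_S _ (S n)), !(Cpow_S z n). ring. }
    eapply Rle_trans; [apply Cmod_triangle|].
    rewrite !Cmod_mult, Cmod_pow, Cmod_R, (Rabs_right (INR (S n)))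
      by (apply Rle_ge, pos_INR).
    pose proof (Cmod_triangle z w) as Ht. pose proof (Cmod_ge_0 E) as HE.
    pose proof (Cmod_ge_0 (z + w)) as Hzw.
    apply Rle_trans with ((Cmod z + Cmod w) *
      ((Cmod z + Cmod w) ^ S n - Cmod z ^ S n - INR (S n) * Cmod w * Cmod z ^ n) +
      INR (S n) * (Cmod w * Cmod w) * Cmod z ^ n).
    + apply Rplus_le_compat_r. apply Rmult_le_compat; assumption.
    + right. rewrite (S_INR (S n)), <- !(tech_pow_Rmult _ (S n)), <- !(tech_pow_Rmult _ n).
      ring.
Qed.

Definition derived_coef (a : nat -> C) (n : nat) : C := (RtoC (INR (S n)) * a (S n))%C.

Lemma Cmod_derived_coef (a : nat -> C) (n : nat) :
  Cmod (derived_coef a n) = PS_derive (fun n => Cmod (a n)) n.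
Proof.
  unfold derived_coef, PS_derive. rewrite Cmod_mult, Cmod_R, Rabs_right; [reflexivity|].
  apply Rle_ge, pos_INR.
Qed.

Lemma is_series_shift_pow (c : nat -> C) (z l : C) :
  @is_series C_AbsRing C_NormedModule (fun n => c n * Cpow z n)%C l ->
  @is_series C_AbsRing C_NormedModule (fun n => c (S n) * Cpow z (S n))%C (l - c 0%nat)%C.
Proof.
  intros H. apply (is_series_incr_1 (K := C_AbsRing) (V := C_NormedModule)
    (fun n => c n * Cpow z n)%C).
  match goal with |- is_series _ ?x => replace x with l; [exact H|] end.
  change (l = ((l - c 0%nat) + c 0%nat * Cpow z 0)%C). simpl. ring.
Qed.

(** By [Cmod_taylor_monomial], the remainder of the expansion of h at z is
    dominated by the remainder at |z| of the real power series of coefficients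
    |a_n|, which is differentiable inside its interval of convergence. *)
Lemma has_expansion_derive_at (a : nat -> C) (h : C -> C) (z D : C) :
  has_expansion a h -> Cmod z < 1 ->
  @is_series C_AbsRing C_NormedModule (fun n => derived_coef a n * Cpow z n)%C D ->
  @is_derive C_AbsRing C_NormedModule h z D.
Proof.
  intros Hh Hz HD. apply is_derive_C. intros eps Heps.
  set (A := fun n => Cmod (a n)). set (x := Cmod z).
  pose proof (has_expansion_radius a h Hh) as HA. fold A in HA.
  pose proof (Cmod_ge_0 z) as Hz0. fold x in Hz, Hz0.
  assert (Hin : forall s, 0 <= s < 1 -> Rbar_lt (Rabs s) (CV_radius A)).
  { intros s Hs. apply Rbar_lt_le_trans with (2 := HA). simpl. rewrite Rabs_right; lra. }
  pose proof (is_derive_PSeries A x (Hin x ltac:(lra))) as Hd.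
  apply is_derive_Reals in Hd. destruct (Hd eps Heps) as [delta Hdelta].
  exists (Rmin delta (1 - x)). split.
  { apply Rmin_pos; [apply cond_pos|lra]. }
  intros y Hy. set (w := (y - z)%C) in *. set (t := Cmod w) in *.
  assert (Ht1 : t < delta) by (eapply Rlt_le_trans; [exact Hy|apply Rmin_l]).
  assert (Ht2 : t < 1 - x) by (eapply Rlt_le_trans; [exact Hy|apply Rmin_r]).
  pose proof (Cmod_ge_0 w) as Ht0. fold t in Ht0.
  assert (Hyw : y = (z + w)%C) by (unfold w; ring).
  assert (Hy1 : Cmod y < 1).
  { rewrite Hyw. eapply Rle_lt_trans; [apply Cmod_triangle|]. fold x t. lra. }
  assert (Hmaj : Cmod (h y - h z - w * D) <=
    PSeries A (x + t) - PSeries A x - t * PSeries (PS_derive A) x).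
  { apply (Cmod_is_series_le
      (fun n => a (S n) * (Cpow (z + w) (S n) - Cpow z (S n)
                           - RtoC (INR (S n)) * w * Cpow z n))%C
      (fun n => A (S n) * ((x + t) ^ S n - x ^ S n - INR (S n) * t * x ^ n))).
    - pose proof (is_series_shift_pow _ _ _ (has_expansion_series a h y Hh Hy1)) as Sy.
      pose proof (is_series_shift_pow _ _ _ (has_expansion_series a h z Hh Hz)) as Sz.
      pose proof (is_series_scal (K := C_AbsRing) (V := C_NormedModule) (- w)%C _ _ HD) as SD.
      pose proof (is_series_plus (K := C_AbsRing) (V := C_NormedModule) _ _ _ _
        (is_series_minus (K := C_AbsRing) (V := C_NormedModule) _ _ _ _ Sy Sz) SD) as HS.
      replace (h y - h z - w * D)%C with
        ((h y - a 0%nat) + - (h z - a 0%nat) + (- w) * D)%C by ring.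
      eapply is_series_ext; [|exact HS].
      intros n. rewrite Hyw. unfold derived_coef.
      change ((a (S n) * Cpow (z + w) (S n) + - (a (S n) * Cpow z (S n)) +
        - w * (RtoC (INR (S n)) * a (S n) * Cpow z n))%C =
        (a (S n) * (Cpow (z + w) (S n) - Cpow z (S n)
                           - RtoC (INR (S n)) * w * Cpow z n))%C). ring.
    - assert (Hs : forall s, 0 <= s < 1 ->
        is_series (fun n => A (S n) * s ^ S n) (PSeries A s - A 0%nat)).
      { intros s Hs.
        apply (is_series_incr_1 (K := R_AbsRing) (V := R_NormedModule) (fun n => A n * s ^ n)).
        match goal with |- is_series _ ?x => replace x with (PSeries A s) end.
        2:{ change (PSeries A s = (PSeries A s - A 0%nat) + A 0%nat * s ^ 0). simpl. ring. }
        apply (proj1 (is_pseries_R A s _)), PSeries_correct, CV_radius_inside, Hin, Hs. }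
      assert (Sx : is_series (fun n => PS_derive A n * x ^ n) (PSeries (PS_derive A) x)).
      { apply (proj1 (is_pseries_R (PS_derive A) x _)), PSeries_correct, CV_radius_inside.
        rewrite CV_radius_derive. apply Hin. lra. }
      pose proof (is_series_scal (K := R_AbsRing) (V := R_NormedModule) (- t) _ _ Sx) as SD.
      pose proof (is_series_plus (K := R_AbsRing) (V := R_NormedModule) _ _ _ _
        (is_series_minus (K := R_AbsRing) (V := R_NormedModule) _ _ _ _
          (Hs (x + t) ltac:(lra)) (Hs x ltac:(lra))) SD) as HS.
      replace (PSeries A (x + t) - PSeries A x - t * PSeries (PS_derive A) x) with
        ((PSeries A (x + t) - A 0%nat) + - (PSeries A x - A 0%nat) +
          (- t) * PSeries (PS_derive A) x) by ring.
      eapply is_series_ext; [|exact HS].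
      intros n. unfold PS_derive.
      change (A (S n) * (x + t) ^ S n + - (A (S n) * x ^ S n) +
        - t * (INR (S n) * A (S n) * x ^ n) =
        A (S n) * ((x + t) ^ S n - x ^ S n - INR (S n) * t * x ^ n)). ring.
    - intros n. rewrite Cmod_mult. apply Rmult_le_compat_l; [apply Cmod_ge_0|].
      apply Cmod_taylor_monomial. }
  apply Rle_trans with (1 := Hmaj).
  destruct (Req_dec t 0) as [E|E].
  { rewrite E, Rplus_0_r. lra. }
  specialize (Hdelta t E ltac:(rewrite Rabs_right; lra)).
  replace (PSeries A (x + t) - PSeries A x - t * PSeries (PS_derive A) x) with
    (t * ((PSeries A (x + t) - PSeries A x) / t - PSeries (PS_derive A) x))
    by (field; exact E).
  rewrite (Rmult_comm eps t). apply Rmult_le_compat_l; [exact Ht0|].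
  apply Rabs_lt_between in Hdelta. lra.
Qed.

Lemma has_expansion_derive (a : nat -> C) (h : C -> C) :
  has_expansion a h -> has_expansion (derived_coef a) (C_derive h).
Proof.
  intros Hh z Hz.
  assert (Hex : @ex_series C_AbsRing C_NormedModule (fun n => derived_coef a n * Cpow z n)%C).
  { apply (ex_series_le (K := C_AbsRing) (V := C_CompleteNormedModule) _
      (fun n => Rabs (PS_derive (fun n => Cmod (a n)) n) * Cmod z ^ n)).
    - intros n. change (norm ?x) with (Cmod x).
      rewrite Cmod_mult, Cmod_pow, Cmod_derived_coef.
      apply Rmult_le_compat_r; [apply pow_le, Cmod_ge_0|apply Rle_abs].
    - apply ex_series_in_disk.
      + rewrite CV_radius_derive. now apply has_expansion_radius with h.
      + split; [apply Cmod_ge_0|exact Hz]. }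
  destruct Hex as [D HD].
  rewrite (is_C_derive_unique h z D (has_expansion_derive_at a h z D Hh Hz HD)).
  eapply is_series_ext; [|exact HD].
  intros n. change ((derived_coef a n * Cpow z n)%C =
    Cmult (@pow_n C_Ring z n) (derived_coef a n)).
  rewrite (pow_n_Cpow z n). ring.
Qed.

(** * Coefficients of the co-analytic part *)

Lemma PSeries_nonneg_of_derive (u : nat -> R) (t : R) :
  Rbar_le 1 (CV_radius u) -> u 0%nat = 0 ->
  (forall s, 0 < s < 1 -> 0 <= PSeries (PS_derive u) s) ->
  0 <= t < 1 -> 0 <= PSeries u t.
Proof.
  intros Hu Hu0 Hd Ht.
  assert (H0 : PSeries u 0 = 0) by now rewrite PSeries_0.
  destruct (Req_dec t 0) as [->|Hne]; [lra|].
  destruct (MVT_cor2 (PSeries u) (PSeries (PS_derive u)) 0 t) as [s [Hs1 Hs2]].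
  - lra.
  - intros s Hs. apply is_derive_Reals, is_derive_PSeries.
    apply Rbar_lt_le_trans with (2 := Hu). simpl. rewrite Rabs_right; lra.
  - specialize (Hd s ltac:(lra)). nra.
Qed.

(** With delta_n = k^2 |a_n|^2 - |b_n|^2, Parseval's identity for the derivatives
    says that the sum of n^2 delta_n t^(n-1) is nonnegative. This is the
    derivative of the sum of n delta_n t^n, which is t times the derivative of
    the sum of delta_n t^n; both sums vanish at 0. *)
Lemma sum_sq_le_of_derive_le (a b : nat -> C) (h g : C -> C) (k t : R) :
  has_expansion a h -> has_expansion b g -> 0 <= k ->
  (forall z, Cmod z < 1 -> Cmod (C_derive g z) <= k * Cmod (C_derive h z)) ->
  0 <= t < 1 ->
  ex_series (fun n => Cmod (b (S n)) ^ 2 * t ^ S n) /\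
  ex_series (fun n => Cmod (a (S n)) ^ 2 * t ^ S n) /\
  Series (fun n => Cmod (b (S n)) ^ 2 * t ^ S n) <=
  k ^ 2 * Series (fun n => Cmod (a (S n)) ^ 2 * t ^ S n).
Proof.
  intros Ha Hb Hk Hgh Ht.
  pose proof (has_expansion_derive a h Ha) as Ha'.
  pose proof (has_expansion_derive b g Hb) as Hb'.
  set (v := fun n => k ^ 2 * Cmod (a (S n)) ^ 2 - Cmod (b (S n)) ^ 2).
  set (w := fun n => k ^ 2 * Cmod (derived_coef a n) ^ 2 - Cmod (derived_coef b n) ^ 2).
  (* [PS_incr_1 v] is delta, [e] is n delta_n and [w] is the derivative of [e] *)
  set (e := PS_incr_1 (PS_derive (PS_incr_1 v))).
  assert (Hexw : forall s, 0 <= s < 1 -> is_series (fun n => w n * s ^ n)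
      (k ^ 2 * Series (fun n => Cmod (derived_coef a n) ^ 2 * s ^ n) -
       Series (fun n => Cmod (derived_coef b n) ^ 2 * s ^ n))).
  { intros s Hs.
    pose proof (Series_correct _ (ex_series_sq_disk _ _ s Ha' Hs)) as Sa.
    pose proof (Series_correct _ (ex_series_sq_disk _ _ s Hb' Hs)) as Sb.
    pose proof (is_series_minus (K := R_AbsRing) (V := R_NormedModule) _ _ _ _
      (is_series_scal (K := R_AbsRing) (V := R_NormedModule) (k ^ 2) _ _ Sa) Sb) as HS.
    eapply is_series_ext; [|exact HS].
    intros n. unfold w.
    change (k ^ 2 * (Cmod (derived_coef a n) ^ 2 * s ^ n) +
      - (Cmod (derived_coef b n) ^ 2 * s ^ n) =
      (k ^ 2 * Cmod (derived_coef a n) ^ 2 - Cmod (derived_coef b n) ^ 2) * s ^ n).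
    ring. }
  assert (Hw : forall n, w n = PS_derive e n).
  { intros n. unfold w, e, PS_derive, PS_incr_1, v.
    rewrite !Cmod_derived_coef. unfold PS_derive. change zero with 0. ring. }
  assert (Re : Rbar_le 1 (CV_radius e)).
  { rewrite <- CV_radius_derive, <- (CV_radius_ext _ _ Hw).
    apply CV_radius_ge_1. intros r Hr.
    apply ex_series_lim_0. eexists. apply Hexw. lra. }
  assert (Rd : Rbar_le 1 (CV_radius (PS_incr_1 v))).
  { unfold e in Re. now rewrite CV_radius_incr_1, CV_radius_derive in Re. }
  assert (Hv : 0 <= PSeries (PS_incr_1 v) t).
  { apply PSeries_nonneg_of_derive; [exact Rd|reflexivity| |exact Ht].
    intros s Hs.
    assert (He : 0 <= PSeries e s).
    { apply PSeries_nonneg_of_derive; [exact Re|reflexivity| |lra].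
      intros q Hq. rewrite <- (PSeries_ext _ _ q Hw). unfold PSeries.
      rewrite (is_series_unique _ _ (Hexw q ltac:(lra))).
      pose proof (parseval_le_disk _ _ _ _ k q Ha' Hb' Hk Hgh ltac:(lra)). lra. }
    unfold e in He. rewrite PSeries_incr_1 in He.
    apply Rmult_le_reg_l with s; lra. }
  assert (Hex : forall (c : nat -> C) (f : C -> C), has_expansion c f ->
     ex_series (fun n => Cmod (c (S n)) ^ 2 * t ^ S n)).
  { intros c f Hc. apply (proj1 (ex_series_incr_1 (fun n => Cmod (c n) ^ 2 * t ^ n))).
    exact (ex_series_sq_disk c f t Hc Ht). }
  pose proof (Hex a h Ha) as Ea. pose proof (Hex b g Hb) as Eb.
  split; [exact Eb|]. split; [exact Ea|].
  rewrite PSeries_incr_1 in Hv. unfold PSeries in Hv. rewrite <- Series_scal_l in Hv.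
  rewrite (Series_ext _ (fun n => k ^ 2 * (Cmod (a (S n)) ^ 2 * t ^ S n) -
     Cmod (b (S n)) ^ 2 * t ^ S n)) in Hv.
  2:{ intros n. unfold v. simpl. ring. }
  rewrite Series_minus, Series_scal_l in Hv; [lra| |exact Eb].
  exact (ex_series_scal_l (K := R_AbsRing) (V := R_NormedModule) (k ^ 2) _ Ea).
Qed.

Lemma is_series_geom_S (r : R) :
  0 <= r < 1 -> is_series (fun n => r ^ S n) (r / (1 - r)).
Proof.
  intros Hr.
  apply (is_series_scal (K := R_AbsRing) (V := R_NormedModule) r (fun n => r ^ n)).
  apply is_series_geom. rewrite Rabs_right; lra.
Qed.

Lemma Series_le_geom (u : nat -> R) (A r : R) :
  0 <= r < 1 -> (forall n, 0 <= u n <= A) ->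
  ex_series (fun n => u n * r ^ S n) /\
  Series (fun n => u n * r ^ S n) <= A * (r / (1 - r)).
Proof.
  intros Hr Hu.
  pose proof (is_series_scal (K := R_AbsRing) (V := R_NormedModule) A _ _
    (is_series_geom_S r Hr)) as HS.
  assert (Hle : forall n, 0 <= u n * r ^ S n <= A * r ^ S n).
  { intros n. pose proof (pow_le r (S n) (proj1 Hr)). specialize (Hu n). nra. }
  split.
  - apply (ex_series_le (K := R_AbsRing) (V := R_CompleteNormedModule) _
      (fun n => A * r ^ S n)); [|eexists; exact HS].
    intros n. change (norm ?x) with (Rabs x). rewrite Rabs_right; [apply Hle|].
    apply Rle_ge, Hle.
  - apply Rle_trans with (Series (fun n => A * r ^ S n)).
    + apply Series_le; [exact Hle|eexists; exact HS].
    + right. exact (is_series_unique _ _ HS).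
Qed.

Lemma ex_series_S_pow (a : nat -> C) (h : C -> C) (r : R) :
  has_expansion a h -> 0 <= r < 1 -> ex_series (fun n => Cmod (a (S n)) * r ^ S n).
Proof.
  intros Hh Hr. apply (proj1 (ex_series_incr_1 (fun n => Cmod (a n) * r ^ n))).
  exact (ex_series_Cmod a h r Hh Hr).
Qed.

(** The inequality of Cauchy and Schwarz in the form
    2 |b_n| <= |b_n|^2 / B + B, summed with weights r^n, for B close to k A. *)
Lemma coanalytic_sum_le (a b : nat -> C) (h g : C -> C) (k A r : R) :
  has_expansion a h -> has_expansion b g -> 0 <= k ->
  (forall z, Cmod z < 1 -> Cmod (C_derive g z) <= k * Cmod (C_derive h z)) ->
  (forall n, Cmod (a (S n)) <= A) -> 0 <= r < 1 ->
  Series (fun n => Cmod (b (S n)) * r ^ S n) <= k * A * (r / (1 - r)).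
Proof.
  intros Ha Hb Hk Hgh HA Hr.
  pose proof (Rle_trans _ _ _ (Cmod_ge_0 _) (HA 0%nat)) as HA0.
  destruct (sum_sq_le_of_derive_le a b h g k r Ha Hb Hk Hgh Hr) as [Eb [Ea Hsq]].
  set (q := r / (1 - r)) in *.
  assert (Hq : 0 <= q) by (apply Rcomplements.Rdiv_le_0_compat; lra).
  assert (Ha2 : Series (fun n => Cmod (a (S n)) ^ 2 * r ^ S n) <= A ^ 2 * q).
  { apply Series_le_geom; [exact Hr|]. intros n. split; [apply pow_le, Cmod_ge_0|].
    apply pow_incr. split; [apply Cmod_ge_0|apply HA]. }
  set (T := Series (fun n => Cmod (b (S n)) ^ 2 * r ^ S n)) in *.
  assert (HT : T <= (k * A) ^ 2 * q) by (rewrite Rpow_mult_distr; nra).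
  assert (HkA : 0 <= k * A) by nra.
  apply le_epsilon. intros eps Heps.
  (* the added term keeps [B] positive when [k * A] vanishes, and contributes at
     most [eps] to the final bound *)
  set (B := k * A + eps / (q + 1)).
  assert (Heq : 0 < eps / (q + 1)) by (apply Rdiv_lt_0_compat; lra).
  assert (HB : 0 < B) by (unfold B; lra).
  pose proof (is_series_plus (K := R_AbsRing) (V := R_NormedModule) _ _ _ _
    (is_series_scal (K := R_AbsRing) (V := R_NormedModule) (/ (2 * B)) _ _ (Series_correct _ Eb))
    (is_series_scal (K := R_AbsRing) (V := R_NormedModule) (B / 2) _ _ (is_series_geom_S r Hr)))
    as HS.
  fold T q in HS.
  apply Rle_trans with (/ (2 * B) * T + B / 2 * q).
  - eapply Rle_trans; [|right; exact (is_series_unique _ _ HS)].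
    apply Series_le; [|eexists; exact HS].
    intros n. pose proof (pow_le r (S n) (proj1 Hr)) as Hp.
    pose proof (Cmod_ge_0 (b (S n))) as Hb0. set (x := Cmod (b (S n))) in *.
    split; [nra|].
    change (x * r ^ S n <= / (2 * B) * (x ^ 2 * r ^ S n) + B / 2 * r ^ S n).
    apply Rminus_le.
    replace (x * r ^ S n - (/ (2 * B) * (x ^ 2 * r ^ S n) + B / 2 * r ^ S n))
      with (- (/ (2 * B) * ((x - B) ^ 2 * r ^ S n))) by (field; lra).
    assert (0 < / (2 * B)) by (apply Rinv_0_lt_compat; lra).
    pose proof (pow2_ge_0 (x - B)).
    assert (0 <= (x - B) ^ 2 * r ^ S n) by (apply Rmult_le_pos; assumption). nra.
  - assert (HTB : / (2 * B) * T <= B / 2 * q).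
    { apply Rmult_le_reg_l with (2 * B); [lra|].
      rewrite <- Rmult_assoc, Rinv_r, Rmult_1_l by lra.
      assert ((k * A) ^ 2 <= B ^ 2) by (apply pow_incr; unfold B; lra). nra. }
    assert (Hx : eps / (q + 1) * q <= eps).
    { apply Rmult_le_reg_r with (q + 1); [lra|].
      replace (eps / (q + 1) * q * (q + 1)) with (eps * q) by (field; lra). nra. }
    unfold B in *. nra.
Qed.

(** * Distance to the boundary of a convex set *)

(** T meets the real axis only at positive points, as otherwise the segment to x0
    would contain 0. Hence the segment between a point below the axis and a
    point above it crosses the axis at a positive point, which says that Re / Im
    is smaller at the lower point. The supremum c of this ratio over the lower
    points gives the line Re = c Im, which keeps T on one side. *)
Lemma convex_separation_zero (T : C -> Prop) (x0 : R) :
  convex_set T -> T (RtoC x0) -> 0 < x0 -> ~ T (RtoC 0) ->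
  exists p q : R, (p <> 0 \/ q <> 0) /\ forall s, T s -> 0 <= p * Re s + q * Im s.
Proof.
  intros HT Hx0 Hpos H0.
  assert (Haxis : forall x, T (x, 0) -> 0 < x).
  { intros x Hx. destruct (Rlt_le_dec 0 x) as [H|H]; [exact H|]. exfalso. apply H0.
    assert (Ht : 0 <= - x / (x0 - x) <= 1).
    { split; [apply Rcomplements.Rdiv_le_0_compat; lra|].
      apply Rmult_le_reg_r with (x0 - x); [lra|].
      unfold Rdiv. rewrite Rmult_assoc, Rinv_l by lra. lra. }
    pose proof (HT (x, 0) (RtoC x0) _ Hx Hx0 Ht) as Hc.
    match type of Hc with T ?c => replace (RtoC 0) with c; [exact Hc|] end.
    unfold RtoC, Cplus, Cmult; simpl. f_equal; field; lra. }
  assert (Hcross : forall s1 s2, T s1 -> T s2 -> 0 < Im s1 -> Im s2 < 0 ->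
    Re s2 / Im s2 <= Re s1 / Im s1).
  { intros [x1 y1] [x2 y2] H1 H2 Hy1 Hy2. simpl in *.
    assert (Ht : 0 <= y1 / (y1 - y2) <= 1).
    { split; [apply Rcomplements.Rdiv_le_0_compat; lra|].
      apply Rmult_le_reg_r with (y1 - y2); [lra|].
      unfold Rdiv. rewrite Rmult_assoc, Rinv_l by lra. lra. }
    pose proof (HT _ _ _ H1 H2 Ht) as Hc.
    assert (Hx : 0 < (x1 * - y2 + x2 * y1) / (y1 - y2)).
    { apply Haxis. match type of Hc with T ?c =>
        match goal with |- T ?d => replace d with c; [exact Hc|] end end.
      unfold RtoC, Cplus, Cmult; simpl. f_equal; field; lra. }
    assert (Hn : 0 < x1 * - y2 + x2 * y1).
    { replace (x1 * - y2 + x2 * y1)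
        with ((x1 * - y2 + x2 * y1) / (y1 - y2) * (y1 - y2)) by (field; lra).
      apply Rmult_lt_0_compat; lra. }
    apply Rminus_le.
    replace (x2 / y2 - x1 / y1) with (- ((x1 * - y2 + x2 * y1) / (y1 * - y2)))
      by (field; lra).
    assert (0 < (x1 * - y2 + x2 * y1) / (y1 * - y2)) by (apply Rdiv_lt_0_compat; nra).
    lra. }
  destruct (Classical_Prop.classic (exists s, T s /\ Im s < 0)) as [[s2 [Hs2 Hy2]]|Hlow].
  2:{ exists 0, 1. split; [right; lra|]. intros s Hs.
      destruct (Rlt_le_dec (Im s) 0) as [H|H]; [exfalso; apply Hlow; now exists s|lra]. }
  destruct (Classical_Prop.classic (exists s, T s /\ 0 < Im s)) as [[s1 [Hs1 Hy1]]|Hup].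
  2:{ exists 0, (-1). split; [right; lra|]. intros s Hs.
      destruct (Rlt_le_dec 0 (Im s)) as [H|H]; [exfalso; apply Hup; now exists s|lra]. }
  destruct (completeness (fun c => exists s, T s /\ Im s < 0 /\ c = Re s / Im s))
    as [c [Hub Hlub]].
  - exists (Re s1 / Im s1). intros x [s [Hs [Hy ->]]]. now apply Hcross.
  - exists (Re s2 / Im s2), s2. now split.
  - exists 1, (- c). split; [left; lra|]. intros s Hs.
    destruct (Rtotal_order (Im s) 0) as [H|[H|H]].
    + assert (Hc : Re s / Im s <= c) by (apply Hub; now exists s).
      replace (1 * Re s + - c * Im s) with ((c - Re s / Im s) * - Im s) by (field; lra).
      nra.
    + assert (0 < Re s).
      { apply Haxis. replace (Re s, 0) with s; [exact Hs|].
        destruct s as [x y]. simpl in *. now rewrite H. }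
      rewrite H. lra.
    + assert (Hc : c <= Re s / Im s).
      { apply Hlub. intros x [s' [Hs' [Hy ->]]]. now apply Hcross. }
      replace (1 * Re s + - c * Im s) with ((Re s / Im s - c) * Im s) by (field; lra).
      nra.
Qed.

(** Multiplying s - v by the conjugate of s0 - v moves v to 0 and s0 to the
    positive real axis. *)
Lemma convex_separation (T : C -> Prop) (s0 v : C) :
  convex_set T -> T s0 -> ~ T v ->
  exists u : C, Cmod u = 1 /\ forall s, T s -> 0 <= Re (u * (s - v)).
Proof.
  intros HT H0 Hv.
  assert (Hne : (s0 - v)%C <> RtoC 0).
  { intros E. apply Hv. replace v with s0; [exact H0|].
    replace s0 with ((s0 - v) + v)%C by ring. rewrite E. ring. }
  set (e := (s0 - v)%C) in *.
  assert (Hce : Cconj e <> RtoC 0).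
  { intros E. apply Hne. rewrite <- (Cconj_conj e), E. unfold Cconj, RtoC. simpl.
    now rewrite Ropp_0. }
  pose proof (proj1 (Cmod_gt_0 e) Hne) as Hme.
  destruct (convex_separation_zero (fun x => exists s, T s /\ x = (Cconj e * (s - v))%C)
    (Cmod e ^ 2)) as [p [q [Hpq Hs]]].
  - intros x y t [s [Hs ->]] [s' [Hs' ->]] Ht.
    exists (RtoC (1 - t) * s + RtoC t * s')%C. split; [now apply HT|].
    rewrite RtoC_minus. ring.
  - exists s0. split; [exact H0|]. fold e. rewrite Cmod2_conj. ring.
  - nra.
  - intros [s [Hs E]]. apply Hv.
    replace v with s; [exact Hs|].
    assert (Es : (s - v)%C = RtoC 0).
    { replace (s - v)%C with (/ Cconj e * (Cconj e * (s - v)))%C by (field; exact Hce).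
      rewrite <- E. ring. }
    replace s with ((s - v) + v)%C by ring. rewrite Es. ring.
  - set (u0 := ((p, (- q)%R) * Cconj e)%C).
    assert (Hu0 : u0 <> RtoC 0).
    { apply Cmult_neq_0; [|exact Hce]. intros E. injection E. intros. lra. }
    pose proof (proj1 (Cmod_gt_0 u0) Hu0) as Hm.
    exists (RtoC (/ Cmod u0) * u0)%C. split.
    + rewrite Cmod_mult, Cmod_R, Rabs_right; [field; lra|].
      apply Rle_ge, Rlt_le, Rinv_0_lt_compat, Hm.
    + intros s HsT. rewrite <- Cmult_assoc, re_scal_l.
      apply Rmult_le_pos; [apply Rlt_le, Rinv_0_lt_compat, Hm|].
      specialize (Hs _ (ex_intro _ s (conj HsT eq_refl))).
      unfold u0. rewrite <- Cmult_assoc, re_mult. simpl Re at 1. simpl Im at 1.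
      lra.
Qed.

(** With u from the separation of v, the function u (h - v) has nonnegative real
    part and the coefficients u a_n, except the constant one u (a_0 - v). *)
Lemma coef_le_complement (T : C -> Prop) (a : nat -> C) (h : C -> C) (v : C) (n : nat) :
  convex_set T -> has_expansion a h -> (forall z, Cmod z < 1 -> T (h z)) ->
  ~ T v -> (1 <= n)%nat -> Cmod (a n) <= 2 * Cmod (a 0%nat - v).
Proof.
  intros HT Hh Himg Hv Hn.
  destruct (convex_separation T (h (RtoC 0)) v HT) as [u [Hu Hsep]]; [|exact Hv|].
  { apply Himg. rewrite Cmod_0. lra. }
  set (c := fun j => match j with 0%nat => (u * (a 0%nat - v))%C | S _ => (u * a j)%C end).
  assert (Hc : has_expansion c (fun z => u * (h z - v))%C).
  { intros z Hz.
    apply (is_series_decr_1 (K := C_AbsRing) (V := C_NormedModule)).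
    pose proof (is_series_scal (K := C_AbsRing) (V := C_NormedModule) u _ _
      (is_series_shift_pow _ _ _ (has_expansion_series a h z Hh Hz))) as HS.
    match goal with |- is_series _ ?x => replace x with (scal u (h z - a 0%nat)%C : C) end.
    - eapply is_series_ext; [|exact HS]. intros n'.
      change ((u * (a (S n') * Cpow z (S n')))%C =
        Cmult (@pow_n C_Ring z (S n')) (u * a (S n'))%C).
      rewrite (pow_n_Cpow z (S n')). ring.
    - change ((u * (h z - a 0%nat))%C =
        (u * (h z - v) + - (1 * (u * (a 0%nat - v))))%C). ring. }
  pose proof (caratheodory_disk c _ n Hc (fun z Hz => Hsep _ (Himg z Hz)) Hn) as H.
  destruct n as [|n]; [lia|]. simpl in H. rewrite Cmod_mult, Hu, Rmult_1_l in H.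
  apply Rle_trans with (1 := H).
  pose proof (re_le_Cmod (u * (a 0%nat - v))) as Hre.
  rewrite Cmod_mult, Hu, Rmult_1_l in Hre. apply Rabs_le_between in Hre.
  simpl in *. lra.
Qed.

Lemma coef_le_boundary (T : C -> Prop) (a : nat -> C) (h : C -> C) (w : C) (n : nat) :
  convex_set T -> has_expansion a h -> (forall z, Cmod z < 1 -> T (h z)) ->
  boundary T w -> (1 <= n)%nat -> Cmod (a n) <= 2 * Cmod (a 0%nat - w).
Proof.
  intros HT Hh Himg [_ Hw] Hn. apply le_epsilon. intros eps Heps.
  assert (Hex : exists v, ~ T v /\ Cmod (v - w) < eps / 2).
  { apply Classical_Prop.NNPP. intros Hno. apply Hw. apply locally_C.
    assert (H2 : 0 < eps / 2) by lra.
    exists (mkposreal _ H2). intros v Hv.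
    apply Classical_Prop.NNPP. intros HTv. apply Hno. exists v. split; [exact HTv|].
    exact Hv. }
  destruct Hex as [v [Hv Hvw]].
  pose proof (coef_le_complement T a h v n HT Hh Himg Hv Hn) as H.
  replace (a 0%nat - v)%C with ((a 0%nat - w) + - (v - w))%C in H by ring.
  pose proof (Cmod_triangle (a 0%nat - w) (- (v - w))) as Ht.
  rewrite Cmod_opp in Ht. lra.
Qed.

Lemma has_expansion_at_0 (a : nat -> C) (h : C -> C) :
  has_expansion a h -> h (RtoC 0) = a 0%nat.
Proof.
  intros Hh.
  assert (H0 : Cmod (RtoC 0) < 1) by (rewrite Cmod_0; lra).
  pose proof (proj1 (is_series_C _ _) (has_expansion_series a h _ Hh H0)) as H.
  assert (E : (h (RtoC 0) - a 0%nat)%C = RtoC 0).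
  { apply Cmod_eq_0. apply Rle_antisym; [|apply Cmod_ge_0].
    apply le_epsilon. intros eps Heps. rewrite Rplus_0_l.
    destruct (H eps Heps) as [N HN]. specialize (HN N (le_n N)).
    assert (HC : forall N, Csum (fun n => a n * Cpow (RtoC 0) n)%C N = a 0%nat).
    { clear. induction N as [|N IH]; [rewrite Csum_0; simpl; ring|].
      rewrite Csum_S, IH, Cpow_S. ring. }
    rewrite HC in HN. rewrite <- Cmod_opp.
    replace (- (h (RtoC 0) - a 0%nat))%C with (a 0%nat - h (RtoC 0))%C by ring. lra. }
  replace (h (RtoC 0)) with ((h (RtoC 0) - a 0%nat) + a 0%nat)%C by ring.
  rewrite E. ring.
Qed.

(** * The radius *)

Lemma div_one_minus_lt (x y : R) : x < y -> y < 1 -> x / (1 - x) < y / (1 - y).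
Proof.
  intros Hxy Hy. apply Rminus_lt.
  replace (x / (1 - x) - y / (1 - y)) with (- ((y - x) / ((1 - x) * (1 - y))))
    by (field; lra).
  assert (0 < (y - x) / ((1 - x) * (1 - y))) by (apply Rdiv_lt_0_compat; nra). lra.
Qed.

Lemma pow_div_one_minus_le (m : nat) (x y : R) :
  (1 <= m)%nat -> 0 <= x -> x <= y -> y < 1 ->
  x ^ m / (1 - x ^ m) <= y ^ m / (1 - y ^ m).
Proof.
  intros Hm Hx Hxy Hy.
  assert (Hle : x ^ m <= y ^ m) by (apply pow_incr; lra).
  assert (Hlt : y ^ m < 1) by (apply pow_lt_1_compat; [lra|lia]).
  destruct Hle as [Hle|Heq]; [|rewrite Heq; lra].
  apply Rlt_le. now apply div_one_minus_lt.
Qed.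

Lemma E_fun_lt (K lambda : R) (m : nat) (x y : R) :
  1 <= K -> 0 < lambda -> (1 <= m)%nat -> 0 <= x -> x < y -> y < 1 ->
  E_fun K lambda m x < E_fun K lambda m y.
Proof.
  intros HK Hl Hm Hx Hxy Hy. unfold E_fun.
  pose proof (pow_div_one_minus_le m x y Hm Hx (Rlt_le _ _ Hxy) Hy) as H1.
  pose proof (div_one_minus_lt x y Hxy Hy) as H2.
  assert (Hc : 0 < 2 * K * lambda / (K + 1)) by (apply Rdiv_lt_0_compat; nra).
  replace (2 * K * lambda * x / ((K + 1) * (1 - x)))
    with (2 * K * lambda / (K + 1) * (x / (1 - x))) by (field; lra).
  replace (2 * K * lambda * y / ((K + 1) * (1 - y)))
    with (2 * K * lambda / (K + 1) * (y / (1 - y))) by (field; lra).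
  nra.
Qed.

Lemma E_fun_continuous (K lambda : R) (m : nat) (x : R) :
  1 <= K -> (1 <= m)%nat -> 0 <= x < 1 -> continuity_pt (E_fun K lambda m) x.
Proof.
  intros HK Hm Hx.
  assert (Hlt : x ^ m < 1) by (apply pow_lt_1_compat; [lra|lia]).
  apply continuity_pt_filterlim.
  apply (ex_derive_continuous (K := R_AbsRing) (V := R_NormedModule)).
  unfold E_fun. auto_derive. repeat split; [lra|].
  apply Rmult_integral_contrapositive_currified; lra.
Qed.

Lemma E_fun_root (K lambda : R) (m : nat) :
  1 <= K -> 0 < lambda -> (1 <= m)%nat ->
  exists r, unique (fun r : R => 0 < r < 1 /\ E_fun K lambda m r = 0) r.
Proof.
  intros HK Hl Hm.
  (* at this point [lambda * r / (1 - r)] equals one half *)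
  set (r1 := / (1 + 2 * lambda)).
  assert (Hr1 : 0 < r1) by (apply Rinv_0_lt_compat; lra).
  assert (Hr1' : r1 < 1).
  { unfold r1. rewrite <- Rinv_1. apply Rinv_lt_contravar; lra. }
  assert (H0 : E_fun K lambda m 0 < 0).
  { unfold E_fun. rewrite pow_i by lia. unfold Rdiv.
    rewrite !Rmult_0_r, !Rmult_0_l. lra. }
  assert (H1 : 0 < E_fun K lambda m r1).
  { unfold E_fun.
    assert (Hp : 0 < r1 ^ m) by now apply pow_lt.
    assert (Hlt : r1 ^ m < 1) by (apply pow_lt_1_compat; [lra|lia]).
    assert (0 < r1 ^ m / (1 - r1 ^ m)) by (apply Rdiv_lt_0_compat; lra).
    replace (2 * K * lambda * r1 / ((K + 1) * (1 - r1))) with (K / (K + 1)).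
    2:{ unfold r1. field. lra. }
    assert (1 / 2 <= K / (K + 1)).
    { apply Rmult_le_reg_r with (K + 1); [lra|].
      replace (K / (K + 1) * (K + 1)) with K by (field; lra). lra. }
    lra. }
  destruct (Ranalysis5.IVT_interv (E_fun K lambda m) 0 r1) as [r [Hr Er]];
    [|lra|exact H0|exact H1|].
  { intros x Hx. apply E_fun_continuous; [exact HK|exact Hm|lra]. }
  assert (Hr0 : 0 < r).
  { destruct (Req_dec r 0) as [E|E]; [rewrite E in Er; lra|lra]. }
  exists r. split; [split; [lra|exact Er]|].
  intros r' [Hr' Er'].
  destruct (Rtotal_order r r') as [H|[H|H]]; [|exact H|].
  - pose proof (E_fun_lt K lambda m r r' HK Hl Hm ltac:(lra) H ltac:(lra)). lra.
  - pose proof (E_fun_lt K lambda m r' r HK Hl Hm ltac:(lra) H ltac:(lra)). lra.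
Qed.

(** * The inequality up to the radius *)

Lemma Cmod_expansion_le (a : nat -> C) (h : C -> C) (A : R) (z : C) :
  has_expansion a h -> (forall n, Cmod (a (S n)) <= A) -> Cmod z < 1 ->
  Cmod (h z) <= Cmod (a 0%nat) + A * (Cmod z / (1 - Cmod z)).
Proof.
  intros Hh HA Hz. pose proof (Cmod_ge_0 z) as Hz0.
  assert (H : Cmod (h z - a 0%nat) <= A * (Cmod z / (1 - Cmod z))).
  { apply (Cmod_is_series_le _ (fun n => A * Cmod z ^ S n) _ _
      (is_series_shift_pow _ _ _ (has_expansion_series a h z Hh Hz))).
    - apply (is_series_scal (K := R_AbsRing) (V := R_NormedModule) A).
      apply is_series_geom_S. lra.
    - intros n. rewrite Cmod_mult, Cmod_pow. apply Rmult_le_compat_r; [|apply HA].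
      apply pow_le, Hz0. }
  replace (h z) with (a 0%nat + (h z - a 0%nat))%C by ring.
  eapply Rle_trans; [apply Cmod_triangle|]. lra.
Qed.

Lemma dist_to_ge_0 (p : C) (T : C -> Prop) : Rbar_le 0 (dist_to p T).
Proof.
  apply Glb_Rbar_correct. intros d [w [_ ->]]. apply Cmod_ge_0.
Qed.

Lemma subordinate_coef_0 (h phi : C -> C) (a : nat -> C) :
  has_expansion a h -> subordinate h phi -> a 0%nat = phi (RtoC 0).
Proof.
  intros Hh [w [_ [_ [Hw0 Hhw]]]].
  rewrite <- (has_expansion_at_0 a h Hh), Hhw, Hw0; [reflexivity|].
  unfold unit_disk. rewrite Cmod_0. lra.
Qed.

Lemma subordinate_coef_le (h phi : C -> C) (a : nat -> C) (d : R) (n : nat) :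
  has_expansion a h -> convex_univalent phi -> subordinate h phi ->
  dist_to (phi (RtoC 0)) (boundary (disk_image phi)) = Finite d ->
  (1 <= n)%nat -> Cmod (a n) <= 2 * d.
Proof.
  intros Hh [_ [_ Hconv]] Hsub Hd Hn.
  pose proof (subordinate_coef_0 h phi a Hh Hsub) as Ha0.
  destruct Hsub as [w [_ [Hw [_ Hhw]]]].
  assert (Himg : forall z, Cmod z < 1 -> disk_image phi (h z)).
  { intros z Hz. exists (w z). split; [now apply Hw|]. symmetry. now apply Hhw. }
  assert (Hlb : Rbar_le (Finite (Cmod (a n) / 2)) (Finite d)).
  { rewrite <- Hd. apply Glb_Rbar_correct. intros x [v [Hv ->]]. simpl.
    pose proof (coef_le_boundary _ a h v n Hconv Hh Himg Hv Hn) as H.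
    rewrite Ha0 in H. lra. }
  simpl in Hlb. lra.
Qed.

Lemma bohr_term_ex_series (a b : nat -> C) (h g : C -> C) (r : R) :
  has_expansion a h -> has_expansion b g -> 0 <= r < 1 -> ex_series (bohr_term a b r).
Proof.
  intros Ha Hb Hr.
  eapply ex_series_ext; [|exact (ex_series_plus (K := R_AbsRing) (V := R_NormedModule)
    _ _ (ex_series_S_pow a h r Ha Hr) (ex_series_S_pow b g r Hb Hr))].
  intros n. unfold bohr_term.
  change (Cmod (a (S n)) * r ^ S n + Cmod (b (S n)) * r ^ S n =
    (Cmod (a (S n)) + Cmod (b (S n))) * r ^ S n). ring.
Qed.

Lemma bohr_inequality (K lambda : R) (m : nat) (f h g : C -> C) (a b : nat -> C)
    (phi : C -> C) (z : C) :
  1 <= K -> 0 < lambda -> (1 <= m)%nat -> admissible K f h g a b phi ->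
  Cmod z < 1 -> E_fun K lambda m (Cmod z) <= 0 ->
  bohr_ineq m lambda h a b phi z.
Proof.
  intros HK Hl Hm [[_ [_ [_ [Hdil1 Hdil2]]]] [Ha [Hb [_ [Hphi Hsub]]]]] Hz HE.
  unfold bohr_ineq.
  pose proof (dist_to_ge_0 (phi (RtoC 0)) (boundary (disk_image phi))) as Hd0.
  destruct (dist_to (phi (RtoC 0)) (boundary (disk_image phi))) as [d| |] eqn:Ed;
    [|exact I|easy].
  simpl in Hd0 |- *.
  set (k := (K - 1) / (K + 1)) in *.
  assert (Hk : 0 <= k) by (apply Rcomplements.Rdiv_le_0_compat; lra).
  assert (Hgh : forall w, Cmod w < 1 -> Cmod (C_derive g w) <= k * Cmod (C_derive h w)).
  { intros w Hw. specialize (Hdil2 w Hw). destruct (Hdil1 w Hw) as [Hne _].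
    unfold dilatation in Hdil2. rewrite Cmod_div in Hdil2 by exact Hne.
    pose proof (proj1 (Cmod_gt_0 _) Hne) as Hpos.
    apply (Rmult_le_compat_r _ _ _ (Rlt_le _ _ Hpos)) in Hdil2.
    unfold Rdiv in Hdil2 at 1. rewrite Rmult_assoc, Rinv_l, Rmult_1_r in Hdil2 by lra.
    exact Hdil2. }
  assert (HA : forall n, Cmod (a (S n)) <= 2 * d).
  { intros n. apply (subordinate_coef_le h phi a d (S n) Ha Hphi Hsub Ed). lia. }
  pose proof (Cmod_ge_0 z) as Hz0. set (r := Cmod z) in *.
  assert (Hr : 0 <= r < 1) by lra.
  assert (Hrm : 0 <= r ^ m < 1).
  { split; [apply pow_le; lra|apply pow_lt_1_compat; [lra|lia]]. }
  pose proof (subordinate_coef_0 h phi a Ha Hsub) as Ha0.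
  assert (H1 : Cmod (h (Cpow z m)) <=
    Cmod (phi (RtoC 0)) + 2 * d * (r ^ m / (1 - r ^ m))).
  { pose proof (Cmod_expansion_le a h (2 * d) (Cpow z m) Ha HA) as H.
    rewrite Cmod_pow, Ha0 in H. apply H. fold r. lra. }
  assert (H2 : Series (bohr_term a b r) <= (1 + k) * (2 * d) * (r / (1 - r))).
  { rewrite (Series_ext _ (fun n => Cmod (a (S n)) * r ^ S n + Cmod (b (S n)) * r ^ S n))
      by (intros n; unfold bohr_term; ring).
    rewrite Series_plus by
      (eapply ex_series_S_pow; [exact Ha||exact Hb|exact Hr]).
    pose proof (coanalytic_sum_le a b h g k (2 * d) r Ha Hb Hk Hgh HA Hr) as Hsb.
    pose proof (proj2 (Series_le_geom (fun n => Cmod (a (S n))) (2 * d) r Hr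
      (fun n => conj (Cmod_ge_0 _) (HA n)))) as Hsa.
    cbv beta in Hsa. lra. }
  (* this is where 1 + k = 2 K / (K + 1) enters *)
  assert (Hkey : 2 * d * (r ^ m / (1 - r ^ m)) + lambda * ((1 + k) * (2 * d) * (r / (1 - r)))
    = d + 2 * d * E_fun K lambda m r).
  { unfold E_fun, k. field. lra. }
  apply (Rmult_le_compat_l lambda) in H2; [|lra].
  assert (2 * d * E_fun K lambda m r <= 0) by nra.
  lra.
Qed.

(** * The extremal half-plane map *)

(** For [c = 1] this maps the disk onto the half-plane of real part above
    minus one half. *)
Definition half_plane_map (c z : C) : C := (c * (z / (1 - z)))%C.

Definition half_plane_coef (c : C) (n : nat) : C :=
  match n with 0%nat => RtoC 0 | S _ => c end.

Lemma one_minus_neq_0 (z : C) : Cmod z < 1 -> (1 - z)%C <> RtoC 0.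
Proof.
  intros Hz E. assert (z = RtoC 1) as ->.
  { replace z with (1 - (1 - z))%C by ring. rewrite E. ring. }
  rewrite Cmod_1 in Hz. lra.
Qed.

Lemma half_plane_expansion (c : C) :
  has_expansion (half_plane_coef c) (half_plane_map c).
Proof.
  intros z Hz. pose proof (one_minus_neq_0 z Hz) as Hne.
  eapply is_series_ext with (fun n => half_plane_coef c n * Cpow z n)%C.
  { intros n. change ((half_plane_coef c n * Cpow z n)%C =
      Cmult (@pow_n C_Ring z n) (half_plane_coef c n)).
    rewrite (pow_n_Cpow z n). ring. }
  assert (Hsum : forall n, Csum (fun n => half_plane_coef c n * Cpow z n)%C n
    = (c * (z / (1 - z)) - c / (1 - z) * Cpow z (S n))%C).
  { induction n as [|n IH].
    - rewrite Csum_0. simpl. field. exact Hne.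
    - rewrite Csum_S, IH, !(Cpow_S z (S n)). simpl half_plane_coef. field. exact Hne. }
  apply is_series_C. intros eps Heps.
  assert (Hlim : is_lim_seq (fun n => Cmod (c / (1 - z)) * Cmod z ^ S n) 0).
  { replace (Finite 0) with (Finite (Cmod (c / (1 - z)) * 0)) by (f_equal; ring).
    apply is_lim_seq_mult'; [apply is_lim_seq_const|].
    apply (is_lim_seq_incr_1 (fun n => Cmod z ^ n)).
    apply is_lim_seq_geom. rewrite Rabs_right; [exact Hz|apply Rle_ge, Cmod_ge_0]. }
  apply is_lim_seq_spec in Hlim. destruct (Hlim (mkposreal eps Heps)) as [N HN].
  exists N. intros n Hn. specialize (HN n Hn). cbn [pos] in HN.
  rewrite Rminus_0_r, Rabs_right in HN
    by (apply Rle_ge, Rmult_le_pos; [apply Cmod_ge_0|apply pow_le, Cmod_ge_0]).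
  rewrite Hsum. unfold half_plane_map.
  replace (c * (z / (1 - z)) - c / (1 - z) * Cpow z (S n) - c * (z / (1 - z)))%C
    with (- (c / (1 - z) * Cpow z (S n)))%C by ring.
  now rewrite Cmod_opp, Cmod_mult, Cmod_pow.
Qed.

Lemma has_expansion_analytic (a : nat -> C) (h : C -> C) :
  has_expansion a h -> analytic_in_disk h.
Proof.
  intros Hh z Hz. exists (C_derive h z).
  apply (has_expansion_derive_at a h z _ Hh Hz).
  exact (has_expansion_series _ _ z (has_expansion_derive a h Hh) Hz).
Qed.

(** The remainder is c (y - z)^2 / ((1 - y) (1 - z)^2), and |1 - y| is at least
    |1 - z| / 2 near z. *)
Lemma half_plane_derive (c z : C) :
  Cmod z < 1 -> C_derive (half_plane_map c) z = (c / ((1 - z) * (1 - z)))%C.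
Proof.
  intros Hz. pose proof (one_minus_neq_0 z Hz) as Hne.
  apply is_C_derive_unique, is_derive_C. intros eps Heps.
  pose proof (proj1 (Cmod_gt_0 _) Hne) as Hpos. set (s := Cmod (1 - z)) in *.
  set (M := Cmod c * (2 / s ^ 3)).
  assert (HM : 0 <= M).
  { apply Rmult_le_pos; [apply Cmod_ge_0|].
    apply Rcomplements.Rdiv_le_0_compat; [lra|now apply pow_lt]. }
  exists (Rmin (s / 2) (eps / (M + 1))). split.
  { apply Rmin_pos; [lra|apply Rdiv_lt_0_compat; lra]. }
  intros y Hy. set (t := Cmod (y - z)) in *.
  assert (Ht1 : t < s / 2) by (eapply Rlt_le_trans; [exact Hy|apply Rmin_l]).
  assert (Ht2 : t < eps / (M + 1)) by (eapply Rlt_le_trans; [exact Hy|apply Rmin_r]).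
  pose proof (Cmod_ge_0 (y - z)) as Ht0. fold t in Ht0.
  assert (Hsy : s / 2 <= Cmod (1 - y)).
  { pose proof (Cmod_triangle (1 - y) (y - z)) as H.
    replace (1 - y + (y - z))%C with (1 - z)%C in H by ring. fold s t in H. lra. }
  assert (Hney : (1 - y)%C <> RtoC 0) by (apply Cmod_gt_0; lra).
  unfold half_plane_map.
  replace (c * (y / (1 - y)) - c * (z / (1 - z)) - (y - z) * (c / ((1 - z) * (1 - z))))%C
    with (c * ((y - z) * (y - z) / ((1 - y) * ((1 - z) * (1 - z)))))%C
    by (field; split; assumption).
  rewrite Cmod_mult, Cmod_div, !Cmod_mult
    by (repeat apply Cmult_neq_0; assumption).
  fold s t.
  assert (Hq : t * t / (Cmod (1 - y) * (s * s)) <= t * t * (2 / s ^ 3)).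
  { unfold Rdiv at 1. apply Rmult_le_compat_l; [nra|].
    replace (2 / s ^ 3) with (/ (s / 2 * (s * s))) by (field; lra).
    apply Rinv_le_contravar; [|apply Rmult_le_compat_r; nra].
    apply Rmult_lt_0_compat; nra. }
  apply Rle_trans with (M * t * t).
  { unfold M. pose proof (Cmod_ge_0 c). nra. }
  apply Rmult_le_compat_r; [exact Ht0|].
  apply Rle_trans with ((M + 1) * (eps / (M + 1))); [nra|].
  right. field. lra.
Qed.

Lemma half_plane_eq (z : C) :
  Cmod z < 1 -> half_plane_map 1 z = (z * (1 + half_plane_map 1 z))%C.
Proof.
  intros Hz. unfold half_plane_map. field. now apply one_minus_neq_0.
Qed.

Lemma Cmod2_one_plus (u : C) : Cmod (1 + u) ^ 2 = Cmod u ^ 2 + 2 * Re u + 1.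
Proof. rewrite !Cmod2_alt. destruct u as [x y]. simpl. ring. Qed.

(** If u = z / (1 - z) then u = z (1 + u), so |z| < 1 means |u| < |1 + u|, that
    is, u is closer to 0 than to -1. *)
Lemma half_plane_image (u : C) :
  disk_image (half_plane_map 1) u <-> - (1 / 2) < Re u.
Proof.
  pose proof (Cmod2_one_plus u) as H2. pose proof (Cmod_ge_0 u) as Hu0.
  pose proof (Cmod_ge_0 (1 + u)) as H10.
  split.
  - intros [z [Hz <-]]. set (u := half_plane_map 1 z) in *.
    pose proof (half_plane_eq z Hz) as E. fold u in E.
    assert (Hne : (1 + u)%C <> RtoC 0).
    { intros E0. rewrite E0, Cmult_0_r in E. rewrite E, Cplus_0_r in E0.
      now apply C1_nz. }
    pose proof (proj1 (Cmod_gt_0 _) Hne) as Hpos.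
    apply (f_equal Cmod) in E. rewrite Cmod_mult in E.
    pose proof (Cmod_ge_0 z) as Hz0. unfold unit_disk in Hz.
    assert (Hlt : Cmod u < Cmod (1 + u)) by nra. nra.
  - intros Hre.
    assert (Hlt : Cmod u < Cmod (1 + u)) by nra.
    assert (Hne : (1 + u)%C <> RtoC 0) by (apply Cmod_gt_0; lra).
    exists (u / (1 + u))%C. split.
    + unfold unit_disk. rewrite Cmod_div by exact Hne.
      apply Rmult_lt_reg_r with (Cmod (1 + u)); [lra|].
      unfold Rdiv. rewrite Rmult_assoc, Rinv_l by lra. lra.
    + unfold half_plane_map. field. split; [exact Hne|].
      replace (1 + u - u)%C with (RtoC 1) by ring. exact C1_nz.
Qed.

Lemma half_plane_convex_univalent : convex_univalent (half_plane_map 1).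
Proof.
  split; [|split].
  - exact (has_expansion_analytic _ _ (half_plane_expansion 1)).
  - intros z w Hz Hw E.
    pose proof (one_minus_neq_0 z Hz) as Hz1. pose proof (one_minus_neq_0 w Hw) as Hw1.
    assert (Hinv : forall v, (1 - v)%C <> RtoC 0 ->
      v = (half_plane_map 1 v * / (1 + half_plane_map 1 v))%C).
    { intros v Hv. unfold half_plane_map. field. split; [exact Hv|].
      replace (1 - v + v)%C with (RtoC 1) by ring. exact C1_nz. }
    rewrite (Hinv z Hz1), (Hinv w Hw1), E. reflexivity.
  - intros u v t Hu Hv Ht. apply half_plane_image in Hu, Hv. apply half_plane_image.
    rewrite re_plus, !re_scal_l.
    assert (0 <= (1 - t) * (Re u + 1 / 2)) by (apply Rmult_le_pos; lra).
    destruct (Rlt_le_dec 0 t) as [Hpos|Hneg].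
    + assert (0 < t * (Re v + 1 / 2)) by (apply Rmult_lt_0_compat; lra). lra.
    + replace t with 0 by lra. lra.
Qed.

Lemma half_plane_boundary : boundary (disk_image (half_plane_map 1)) (RtoC (- (1 / 2))).
Proof.
  split.
  - intros [eps Heps]. pose proof (cond_pos eps) as Hpos.
    apply (Heps (RtoC (- (1 / 2) + eps / 2))).
    + apply C_NormedModule_mixin_compat1.
      change (Cmod (RtoC (- (1 / 2) + eps / 2) - RtoC (- (1 / 2))) < eps).
      rewrite <- RtoC_minus, Cmod_R, Rabs_right; lra.
    + apply half_plane_image. rewrite re_RtoC. lra.
  - intros H. apply locally_singleton in H. apply half_plane_image in H.
    rewrite re_RtoC in H. lra.
Qed.

Lemma half_plane_map_0 (c : C) : half_plane_map c (RtoC 0) = RtoC 0.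
Proof. unfold half_plane_map. field. Qed.

Lemma half_plane_dist :
  Rbar_le (dist_to (half_plane_map 1 (RtoC 0)) (boundary (disk_image (half_plane_map 1))))
    (1 / 2).
Proof.
  apply Glb_Rbar_correct. exists (RtoC (- (1 / 2))). split; [exact half_plane_boundary|].
  rewrite half_plane_map_0, <- RtoC_minus, Cmod_R, Rabs_right; lra.
Qed.

Lemma half_plane_admissible (K : R) (k := RtoC ((K - 1) / (K + 1))) :
  1 <= K ->
  admissible K (fun z => half_plane_map 1 z + Cconj (half_plane_map k z))%C
    (half_plane_map 1) (half_plane_map k) (half_plane_coef 1) (half_plane_coef k)
    (half_plane_map 1).
Proof.
  intros HK.
  assert (Hk : 0 <= (K - 1) / (K + 1) < 1).
  { split; [apply Rcomplements.Rdiv_le_0_compat; lra|].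
    apply Rmult_lt_reg_r with (K + 1); [lra|].
    unfold Rdiv. rewrite Rmult_assoc, Rinv_l by lra. lra. }
  assert (Hdil : forall z, unit_disk z ->
    C_derive (half_plane_map 1) z <> RtoC 0 /\
    Cmod (dilatation (half_plane_map 1) (half_plane_map k) z) = (K - 1) / (K + 1)).
  { intros z Hz. pose proof (one_minus_neq_0 z Hz) as Hne.
    assert (Hd : C_derive (half_plane_map 1) z <> RtoC 0).
    { rewrite half_plane_derive by exact Hz. unfold Cdiv. rewrite Cmult_1_l.
      intros E. apply C1_nz.
      rewrite <- (Cinv_r ((1 - z) * (1 - z))), E; [ring|now apply Cmult_neq_0]. }
    split; [exact Hd|].
    unfold dilatation. rewrite !half_plane_derive by exact Hz.
    replace (k / ((1 - z) * (1 - z)) / (1 / ((1 - z) * (1 - z))))%C with k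
      by (field; exact Hne).
    unfold k. rewrite Cmod_R. apply Rabs_right. lra. }
  split; [|split; [|split; [|split; [|split]]]].
  - split; [|split; [|split; [|split]]].
    + exact (has_expansion_analytic _ _ (half_plane_expansion 1)).
    + exact (has_expansion_analytic _ _ (half_plane_expansion k)).
    + reflexivity.
    + intros z Hz. destruct (Hdil z Hz) as [H1 H2]. split; [exact H1|lra].
    + intros z Hz. destruct (Hdil z Hz) as [H1 H2]. lra.
  - apply half_plane_expansion.
  - apply half_plane_expansion.
  - reflexivity.
  - exact half_plane_convex_univalent.
  - exists (fun z => z). split; [|split; [|split]]; try easy.
    intros z _. exists (RtoC 1). apply is_derive_C. intros eps Heps.
    exists 1. split; [lra|]. intros y _.
    replace (y - z - (y - z) * 1)%C with (RtoC 0) by ring. rewrite Cmod_0.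
    apply Rmult_le_pos; [lra|apply Cmod_ge_0].
Qed.

(** Here every estimate of [bohr_inequality] is an equality, and the left-hand
    side exceeds the right-hand side by E(r). *)
Lemma half_plane_bohr_fails (K lambda : R) (m : nat) (r : R)
    (k := RtoC ((K - 1) / (K + 1))) :
  1 <= K -> (1 <= m)%nat -> 0 < r < 1 -> 0 < E_fun K lambda m r ->
  ~ bohr_ineq m lambda (half_plane_map 1) (half_plane_coef 1) (half_plane_coef k)
      (half_plane_map 1) (RtoC r).
Proof.
  intros HK Hm Hr HE H. unfold bohr_ineq in H.
  pose proof half_plane_dist as Hd.
  destruct (dist_to _ _) as [d| |]; simpl in Hd; [|easy|simpl in H; easy].
  simpl in H. rewrite half_plane_map_0, Cmod_0, Rplus_0_l in H.
  assert (Hk : 0 <= (K - 1) / (K + 1)) by (apply Rcomplements.Rdiv_le_0_compat; lra).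
  assert (Hrm : 0 <= r ^ m < 1).
  { split; [apply pow_le; lra|apply pow_lt_1_compat; [lra|lia]]. }
  assert (H1 : Cmod (half_plane_map 1 (Cpow (RtoC r) m)) = r ^ m / (1 - r ^ m)).
  { unfold half_plane_map. rewrite <- RtoC_pow, Cmult_1_l, <- RtoC_minus, <- RtoC_div by lra.
    rewrite Cmod_R. apply Rabs_right, Rle_ge, Rcomplements.Rdiv_le_0_compat; lra. }
  assert (H2 : Series (bohr_term (half_plane_coef 1) (half_plane_coef k) (Cmod (RtoC r))) =
    (1 + (K - 1) / (K + 1)) * (r / (1 - r))).
  { rewrite Cmod_R, Rabs_right by lra.
    rewrite (Series_ext _ (fun n => (1 + (K - 1) / (K + 1)) * r ^ S n)).
    - rewrite Series_scal_l. f_equal. apply is_series_unique, is_series_geom_S. lra.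
    - intros n. unfold bohr_term, half_plane_coef, k.
      rewrite Cmod_1, Cmod_R, (Rabs_right ((K - 1) / (K + 1))) by lra. reflexivity. }
  rewrite H1, H2 in H.
  assert (Hkey : r ^ m / (1 - r ^ m) + lambda * ((1 + (K - 1) / (K + 1)) * (r / (1 - r)))
    = 1 / 2 + E_fun K lambda m r) by (unfold E_fun; field; lra).
  lra.
Qed.

Theorem theorem2p2 (K lambda : R) (m : nat)
    (hK : 1 <= K) (hlambda : 0 < lambda) (hm : (1 <= m)%nat) :
  exists Rstar : R,
    unique (fun r : R => 0 < r < 1 /\ E_fun K lambda m r = 0) Rstar /\
    (forall (f h g : C -> C) (a b : nat -> C) (phi : C -> C),
       admissible K f h g a b phi ->
       forall z : C, Cmod z <= Rstar ->
         ex_series (bohr_term a b (Cmod z)) /\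
         bohr_ineq m lambda h a b phi z) /\
    (Rstar <= 1 / 3 ->
     forall rho : R, Rstar < rho < 1 ->
       exists (f h g : C -> C) (a b : nat -> C) (phi : C -> C),
         admissible K f h g a b phi /\
         exists z : C, Cmod z <= rho /\ ~ bohr_ineq m lambda h a b phi z).
Proof.
  destruct (E_fun_root K lambda m hK hlambda hm) as [Rs HRs].
  pose proof HRs as [[HRs01 HRs0] _].
  exists Rs. split; [exact HRs|]. split.
  - intros f h g a b phi Hadm z Hz. pose proof (Cmod_ge_0 z) as Hz0. split.
    + destruct Hadm as [_ [Ha [Hb _]]].
      apply (bohr_term_ex_series a b h g); [exact Ha|exact Hb|lra].
    + apply (bohr_inequality K lambda m f h g a b phi z); try assumption; [lra|].
      destruct Hz as [Hz|Hz]; [|rewrite Hz; lra].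
      rewrite <- HRs0. apply Rlt_le, E_fun_lt; try assumption. lra.
  - intros _ rho Hrho.
    do 6 eexists. split; [exact (half_plane_admissible K hK)|].
    exists (RtoC rho). split; [rewrite Cmod_R, Rabs_right; lra|].
    apply half_plane_bohr_fails; [exact hK|exact hm|lra|].
    rewrite <- HRs0. apply E_fun_lt; try assumption; lra.
Qed.
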